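(* Let $p>2$ be a prime and $n\ge 2$. Then $\Gamma_0(p^n)$ has a Farey sequence $\{e_i\}$ (in the sense defined in the context) such that $$e_i\le \frac{f_{p+1}}{2}\,p^{n-1}+f_p\,p^{n/2}\quad\text{for all } i,$$ where $f_m$ denotes the $m$-th Fibonacci number ($f_1=f_2=1$, $f_m=f_{m-1}+f_{m-2}$).
   Context: $\Gamma_0(N)$ is the subgroup of $PSL(2,\mathbb Z)$ of matrices whose $(2,1)$-entry is divisible by $N$. A (finite) Farey sequence is a sequence of positive integers obtained from the sequence $(1,1)$ by repeatedly choosing two adjacent terms $a,b$ and inserting $a+b$ between them; equivalently, it is the sequence of denominators $e_1,\dots,e_m$ of reduced fractions $0/1=a_1/e_1<\dots<a_m/e_m=1/1$ with $a_{i+1}e_i-a_ie_{i+1}=1$. A side is an ordered pair $(e_i,e_{i+1})$ of consecutive terms. For fixed $N$, a side $(a,b)$ is even if $N\mid a^2+b^2$, odd if $N\mid a^2+ab+b^2$, elliptic if it is even or odd; two distinct sides $(a,b),(x,y)$ are paired if $N\mid ax+by$. For $r=\lfloor\sqrt N\rfloor$, $F_r$ is the ordered sequence of denominators of the Farey fractions in $[0,1]$ with denominator $\le r$. A Farey sequence $F$ is a Farey sequence of $\Gamma_0(N)$ if it is obtained from $F_r$ by the insertion process, has $1+\lfloor [PSL(2,\mathbb Z):\Gamma_0(N)]/3\rfloor$ terms, and every non-elliptic side of $F$ is paired with exactly one other side of $F$. *)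

(* Defs.v *)
From HB Require Import structures.
From mathcomp Require Import all_boot all_order all_algebra.
From mathcomp Require Import all_classical all_reals all_analysis.

Set Implicit Arguments.
Unset Strict Implicit.
Unset Printing Implicit Defensive.

Import Order.TTheory GRing.Theory Num.Theory.

Local Open Scope classical_set_scope.
Local Open Scope ring_scope.

Record SL2Z := MkSL2Z { SL2Z_val : 'M[int]_2; _ : \det SL2Z_val == 1 }.

HB.instance Definition _ := [isSub for SL2Z_val].
HB.instance Definition _ := [Choice of SL2Z by <:].

Section SL2ZGroup.

Implicit Types A B C : SL2Z.

Lemma det_SL2Z A : \det (val A) = 1.
Proof. exact/eqP/(valP A). Qed.

Lemma SL2Z_unitmx A : val A \in unitmx.
Proof. by rewrite unitmxE det_SL2Z unitr1. Qed.

Fact SL2Z_one_subproof : \det (1%:M : 'M[int]_2) == 1.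
Proof. by rewrite det1. Qed.

Fact SL2Z_mul_subproof A B : \det (val A *m val B) == 1.
Proof. by rewrite det_mulmx !det_SL2Z. Qed.

Fact SL2Z_inv_subproof A : \det (invmx (val A)) == 1.
Proof. by rewrite det_inv det_SL2Z invr1. Qed.

Definition SL2Z_one : SL2Z := MkSL2Z SL2Z_one_subproof.
Definition SL2Z_mul A B : SL2Z := MkSL2Z (SL2Z_mul_subproof A B).
Definition SL2Z_inv A : SL2Z := MkSL2Z (SL2Z_inv_subproof A).

Fact SL2Z_mulA : associative SL2Z_mul.
Proof. by move=> A B C; apply: val_inj; rewrite /= mulmxA. Qed.

Fact SL2Z_mul1l : left_id SL2Z_one SL2Z_mul.
Proof. by move=> A; apply: val_inj; rewrite /= mul1mx. Qed.

Fact SL2Z_mul1r : right_id SL2Z_one SL2Z_mul.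
Proof. by move=> A; apply: val_inj; rewrite /= mulmx1. Qed.

Fact SL2Z_mulVl : left_inverse SL2Z_one SL2Z_inv SL2Z_mul.
Proof. by move=> A; apply: val_inj; rewrite /= mulVmx ?SL2Z_unitmx. Qed.

Fact SL2Z_mulVr : right_inverse SL2Z_one SL2Z_inv SL2Z_mul.
Proof. by move=> A; apply: val_inj; rewrite /= mulmxV ?SL2Z_unitmx. Qed.

HB.instance Definition _ := isGroup.Build SL2Z
  SL2Z_mulA SL2Z_mul1l SL2Z_mul1r SL2Z_mulVl SL2Z_mulVr.

Definition eq_up_to_sign A B := (val A == val B) || (val A == - val B).

Fact eq_up_to_sign_refl : reflexive eq_up_to_sign.
Proof. by move=> A; rewrite /eq_up_to_sign eqxx. Qed.

Fact eq_up_to_sign_sym : symmetric eq_up_to_sign.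
Proof.
by move=> A B; rewrite /eq_up_to_sign eq_sym -eqr_oppLR [- _ == _]eq_sym.
Qed.

Fact eq_up_to_sign_trans : transitive eq_up_to_sign.
Proof.
rewrite /eq_up_to_sign => B A C /orP[]/eqP-> // /orP[]/eqP->.
  by rewrite eqxx orbT.
by rewrite opprK eqxx.
Qed.

Canonical eq_up_to_sign_equiv :=
  EquivRel eq_up_to_sign
    eq_up_to_sign_refl eq_up_to_sign_sym eq_up_to_sign_trans.

Lemma eq_up_to_sign_mul A A' B B' :
  eq_up_to_sign A A' -> eq_up_to_sign B B' ->
  eq_up_to_sign (A * B)%g (A' * B')%g.
Proof.
by rewrite /eq_up_to_sign /= => /orP[]/eqP-> /orP[]/eqP->;
  rewrite ?mulNmx ?mulmxN ?opprK eqxx ?orbT.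
Qed.

Lemma eq_up_to_sign_inv A A' :
  eq_up_to_sign A A' -> eq_up_to_sign A^-1%g A'^-1%g.
Proof.
rewrite /eq_up_to_sign /= => /orP[]/eqP->; rewrite ?eqxx //.
have uA : -1 *: val A' \in unitmx.
  by rewrite unitmxE detZ det_SL2Z mulr1 sqrrN expr1n unitr1.
by rewrite -scaleN1r (invmxZ uA) invrN1 scaleN1r eqxx orbT.
Qed.

End SL2ZGroup.

Definition PSL2Z := {eq_quot eq_up_to_sign}%qT.

HB.instance Definition _ : EqQuotient _ eq_up_to_sign PSL2Z :=
  EqQuotient.on PSL2Z.
HB.instance Definition _ := Choice.on PSL2Z.

Section PSL2ZGroup.

Local Open Scope quotient_scope.

Definition PSL2Z_one : PSL2Z := \pi_PSL2Z (1%g : SL2Z).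
Definition PSL2Z_mul (x y : PSL2Z) : PSL2Z := \pi_PSL2Z (repr x * repr y)%g.
Definition PSL2Z_inv (x : PSL2Z) : PSL2Z := \pi_PSL2Z (repr x)^-1%g.

Lemma pi_PSL2Z_mul (A B : SL2Z) :
  PSL2Z_mul (\pi A) (\pi B) = \pi_PSL2Z (A * B)%g.
Proof. by apply/eqmodP/eq_up_to_sign_mul; apply/eqmodP; rewrite reprK. Qed.

Lemma pi_PSL2Z_inv (A : SL2Z) : PSL2Z_inv (\pi A) = \pi_PSL2Z A^-1%g.
Proof. by apply/eqmodP/eq_up_to_sign_inv; apply/eqmodP; rewrite reprK. Qed.

Fact PSL2Z_mulA : associative PSL2Z_mul.
Proof.
by elim/quotW=> A; elim/quotW=> B; elim/quotW=> C; rewrite !pi_PSL2Z_mul mulgA.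
Qed.

Fact PSL2Z_mul1l : left_id PSL2Z_one PSL2Z_mul.
Proof. by elim/quotW=> A; rewrite pi_PSL2Z_mul mul1g. Qed.

Fact PSL2Z_mul1r : right_id PSL2Z_one PSL2Z_mul.
Proof. by elim/quotW=> A; rewrite pi_PSL2Z_mul mulg1. Qed.

Fact PSL2Z_mulVl : left_inverse PSL2Z_one PSL2Z_inv PSL2Z_mul.
Proof. by elim/quotW=> A; rewrite pi_PSL2Z_inv pi_PSL2Z_mul mulVg. Qed.

Fact PSL2Z_mulVr : right_inverse PSL2Z_one PSL2Z_inv PSL2Z_mul.
Proof. by elim/quotW=> A; rewrite pi_PSL2Z_inv pi_PSL2Z_mul mulgV. Qed.

HB.instance Definition _ := isGroup.Build PSL2Z
  PSL2Z_mulA PSL2Z_mul1l PSL2Z_mul1r PSL2Z_mulVl PSL2Z_mulVr.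

Definition Gamma0 (N : nat) : set PSL2Z :=
  [set \pi_PSL2Z A | A in [set A : SL2Z | (N%:Z %| val A 1%R 0%R)%Z]].

End PSL2ZGroup.

Definition left_cosets (G : groupType) (H : set G) : set (set G) :=
  [set [set (g * h)%g | h in H] | g in [set: G]].

Definition has_index (G : groupType) (H : set G) (k : nat) : Prop :=
  (left_cosets H #= `I_k)%card.

Inductive mediant_insertions (s : seq nat) : seq nat -> Prop :=
| mediant_insertions_refl : mediant_insertions s s
| mediant_insertions_step (s1 s2 : seq nat) (a b : nat) :
    mediant_insertions s (s1 ++ [:: a, b & s2]) ->
    mediant_insertions s (s1 ++ [:: a, (a + b)%N, b & s2]).

Definition farey_sequence (s : seq nat) : Prop :=
  mediant_insertions [:: 1%N; 1%N] s.

Definition farey_fractions (r : nat) : seq rat :=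
  sort <=%R (undup [seq a%:R / b%:R | b <- iota 1 r, a <- iota 0 b.+1]).

Definition farey_denominators (r : nat) : seq nat :=
  [seq `|denq x|%N | x <- farey_fractions r].

(* The sides of a Farey sequence are pairwise distinct as pairs of integers,
   so a side need not record its position. *)
Definition sides (s : seq nat) : seq (nat * nat) := zip s (behead s).

Section GammaSides.

Local Open Scope nat_scope.

Variable N : nat.
Implicit Types t u : nat * nat.

Definition even_side t := N %| t.1 ^ 2 + t.2 ^ 2.
Definition odd_side t := N %| t.1 ^ 2 + t.1 * t.2 + t.2 ^ 2.
Definition elliptic_side t := even_side t || odd_side t.
Definition paired_sides t u := (t != u) && (N %| t.1 * u.1 + t.2 * u.2).

Record farey_sequence_of_Gamma0 (F : seq nat) : Prop := {
  Gamma0_farey : farey_sequence F;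
  Gamma0_refines : mediant_insertions (farey_denominators (Nat.sqrt N)) F;
  Gamma0_size :
    exists2 k, has_index (Gamma0 N) k & size F = 1 + k %/ 3;
  Gamma0_pairing :
    forall t, t \in sides F -> ~~ elliptic_side t ->
      exists! u, u \in sides F /\ paired_sides t u }.

End GammaSides.

Fixpoint fibonacci (m : nat) : nat :=
  match m with
  | 0 => 0
  | 1 => 1
  | (m'.+1 as m1).+1 => fibonacci m1 + fibonacci m'
  end.

(* Main.v *)
Require Import Defs.
From mathcomp Require Import all_boot all_order all_algebra.
From mathcomp Require Import all_classical all_reals all_analysis.
From mathcomp Require Import zify ring lra.

Import Order.TTheory GRing.Theory Num.Theory.
Local Open Scope ring_scope.

(** Let N = p^n and r = floor (sqrt N). Up to Gamma_0(N), the oriented edges of the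
Farey tessellation are the points of P^1(Z/N), through their pairs of denominators
(a, b): reversing an edge is (a, b) |-> (b, - a), and rotating the triangle on one of
its sides is (a, b) |-> (b, - (a + b)). A Farey sequence whose triangles are pairwise
inequivalent and represent all classes (but those of the triangles fixed by an element
of order 3) has the right length, and its sides are paired as required.

Starting from F_r, insert the mediant of a side (a, b) whenever its outer triangle has
a new class and either a, b <= r or a x + b y = N for some multiples x, y of p in
[1, r]. In the first case a + b <= 2 r, in the second p (a + b) <= N, so all terms
are at most max (2 r, p^(n-1)), which is below the bound because f_p >= 2 and
f_(p+1) >= 2.

It remains to see that every class is reached. The vectors representing a class form a
lattice of index N, which by Thue's lemma has a nonzero vector u with entries in [- r,
r]. If p does not divide u, then up to rotation and sign u is a side with entries at
most r. If p divides u, then either another vector of the lattice has this form, or up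
to rotation u = (- y, x) with a x + b y = N for a representative (a, b) of the class.
In the last case one descends: taking the mediant turns the vector (x, y) into (x - y,
y) or (x, y - x), so that the parent of (a, b) comes with a longer (x, y), until the
parent has entries at most r. The insertions cannot leave this descent, because the
short vector (- y, x) is, among the vectors divisible by p, unique up to sign in its
lattice. *)

(** * Determinants of integer vectors and elementary inequalities *)

Definition cross (u v : int * int) : int := u.1 * v.2 - u.2 * v.1.
Definition rot (u : int * int) : int * int := (u.2, - u.1).
Definition tau (u : int * int) : int * int := (u.2, - (u.1 + u.2)).

Lemma cross_rot u v : cross (rot u) (rot v) = cross u v.
Proof. by rewrite /cross /rot /=; ring. Qed.

Lemma cross_tau u v : cross (tau u) (tau v) = cross u v.
Proof. by rewrite /cross /tau /=; ring. Qed.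

Lemma ltn_dvdz_eq (m i j : nat) :
  (i < m)%N -> (j < m)%N -> (m%:Z %| i%:Z - j%:Z)%Z -> i = j.
Proof.
move=> im jm /dvdzP[q ijq]; suff: q = 0 by lia.
by have /= := ijq; nia.
Qed.

Lemma coprimez_inv (m : nat) (a : int) : (0 < m)%N -> coprimez m%:Z a ->
  exists b : 'I_m, (m%:Z %| a * b%:Z - 1)%Z.
Proof.
move=> m_gt0 /coprimezP[[k b] /= kb].
have m_neq0 : m%:Z != 0 by case: (m) m_gt0.
have bm : (absz (b %% m)%Z < m)%N.
  by rewrite -ltz_nat gez0_abs ?modz_ge0 // ltz_pmod.
exists (Ordinal bm); rewrite /= gez0_abs ?modz_ge0 //.
apply/dvdzP; exists (- k - a * (b %/ m)%Z).
by rewrite [in X in X * a](divz_eq b m) in kb; have := kb; nia.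
Qed.

Lemma sides_cat s1 a s2 :
  sides (s1 ++ a :: s2) = sides (rcons s1 a) ++ sides (a :: s2).
Proof.
elim: s1 => [|x [|y s] IH] //.
by rewrite rcons_cons !cat_cons /sides /= -/(sides _) -/(sides _) -cat_cons IH.
Qed.

Lemma sides_split s t : t \in sides s ->
  exists s1 s2, s = s1 ++ [:: t.1, t.2 & s2].
Proof.
elim: s => [|x [|y s] IH] //; rewrite inE => /predU1P[->|/IH[s1 [s2 E]]].
  by exists [::], s.
by exists (x :: s1), s2; rewrite E.
Qed.

(** The vector [(x' - y', y')] pairs with a left child [(c, c + e)] as [(x', y')] does with
    [(c, e)]; this determinant compares it with [(x, y)]. *)
Lemma short_det (M K r x y x' y' : int) :
    0 < x -> x <= r -> 0 < y -> y <= r -> 0 < x' -> x' <= r -> 0 < y' -> y' <= r ->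
    r * r <= M -> 3 * M <= K ->
  - K < x * y' - y * (x' - y') < K.
Proof.
move=> x0 xr y0 yr x'0 x'r y'0 y'r rM MK.
have h1 : 0 <= y * x' <= r * r by nia.
have h2 : 0 <= x * y' <= r * r by nia.
have h3 : 0 < y * y' <= r * r by nia.
rewrite mulrBr; move: (y * x') (x * y') (y * y') (r * r) h1 h2 h3 rM => A B C D.
by clear -MK; lia.
Qed.

Lemma mul_le_sqr (r a b : int) : 0 < a -> a <= r -> 0 < b -> b <= r -> a * b <= r * r.
Proof. by nia. Qed.

Lemma mul_eq_sqr (r a b : int) : 0 < a -> a <= r -> 0 < b -> b <= r -> r * r <= a * b -> a = r.
Proof. by nia. Qed.

Lemma unitz_pos (k m y y' : int) : 0 < y -> 0 < y' -> y = k * y' -> k * m = 1 -> k = 1.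
Proof.
move=> y0 y'0 yk km; have k0 : 0 < k by rewrite yk pmulr_lgt0 in y0.
have m0 : 0 < m by rewrite -(pmulr_rgt0 _ k0) km.
by clear -km k0 m0; nia.
Qed.

Lemma dvdz_small (M D : int) : - M < D -> D < M -> (M %| D)%Z -> D = 0.
Proof.
move=> D1 D2 /dvdzP[q]; case: (ltgtP q 0) => [q0|q0|->] Dq; [nia | nia |].
by rewrite Dq mul0r.
Qed.

(** Each unit of [j] changes [b - a] by [x + y], so rounding [(b - a) / (x + y)] to the nearest
    integer leaves at most half of [x + y]. *)
Lemma balance (a b x y : int) : 0 < x -> 0 < y ->
  exists j, - (x + y) <= 2 * ((b + j * x) - (a - j * y)) <= x + y.
Proof.
move=> x0 y0; exists (- ((2 * (b - a) + (x + y)) %/ (2 * (x + y)))%Z).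
have s0 : 0 < 2 * (x + y) by clear -x0 y0; lia.
have := divz_eq (2 * (b - a) + (x + y)) (2 * (x + y)).
have := ltz_pmod (2 * (b - a) + (x + y)) s0.
have := modz_ge0 (2 * (b - a) + (x + y)) (lt0r_neq0 s0).
move: (_ %% _)%Z (_ %/ _)%Z => m q m0 ms E.
have -> : 2 * (b + - q * x - (a - - q * y)) = m - (x + y).
  have -> : m = 2 * (b - a) + (x + y) - q * (2 * (x + y)) by rewrite E; ring.
  by ring.
by clear -m0 ms; lia.
Qed.

(** Here [a * (x + y) = M - (b - a) * y >= M - r * r >= 0]. Equality forces [b = y = r], a case
    excluded later because [(0, y)] is divisible by p. *)
Lemma balanced_pos (r M a b x y : int) :
    0 < x -> x <= r -> 0 < y -> y <= r -> r * r <= M -> a * x + b * y = M ->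
    2 * (b - a) <= x + y ->
  a = 0 /\ b = y \/ 0 < a.
Proof.
move=> x0 xr y0 yr rM E bal.
have h1 : 2 * (b - a) * y <= (x + y) * y by rewrite ler_pM2r.
have h2 : (x + y) * y <= 2 * (r * r) by clear -x0 xr y0 yr; nia.
have h3 : 2 * a * (x + y) = 2 * M - 2 * (b - a) * y by rewrite -E; ring.
case: (ltgtP 0 a) => [a0|a0|a0]; [by right | exfalso | left].
  have h4 : a * (x + y) < 0 by rewrite nmulr_rlt0 // addr_gt0.
  by move: (a * (x + y)) (2 * (b - a) * y) ((x + y) * y) (r * r) (mulrA 2 a (x + y))
    h1 h2 h3 h4 rM => A B C D <-; clear; lia.
rewrite -a0 mul0r add0r in E; rewrite -a0 subr0 in bal.
have br : b <= r by clear -bal xr yr; lia.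
have r0 : 0 < r by apply: lt_le_trans yr.
have b0 : 0 < b.
  by rewrite -(pmulr_lgt0 _ y0) E; apply: lt_le_trans rM; rewrite mulr_gt0.
rewrite -E in rM; split=> //; rewrite (mul_eq_sqr r b y) //.
by rewrite (mul_eq_sqr r y b) // [y * b]mulrC.
Qed.

Lemma mulr_ge0_same (a b : int) : 0 <= a * b ->
  (0 <= a) && (0 <= b) || (a <= 0) && (b <= 0).
Proof.
case: (ltgtP a 0) => [a0|a0|->]; last by case: (leP 0 b) => //= /ltW ->.
  by rewrite nmulr_rge0.
by rewrite pmulr_rge0 // => ->.
Qed.

Lemma residue_window (r c w : int) : 0 < c ->
  exists q, r - c < w + q * c <= r.
Proof.
move=> c0; exists ((r - w) %/ c)%Z.
have := divz_eq (r - w) c.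
have := ltz_pmod (r - w) c0; have := modz_ge0 (r - w) (lt0r_neq0 c0).
move: (_ %% _)%Z (_ %/ _)%Z => m q m0 ms E.
have -> : w + q * c = r - m by apply/eqP; rewrite -subr_eq0; apply/eqP; lia.
by clear -m0 ms; lia.
Qed.

(** Write [M = c * (x - y) + (c + d) * y]. If [x - y > r], the terms are at least [c * (r + 1)] and
    [(r + 1) * (r - c + 1)], with sum [(r + 1) * (r + 1)]. *)
Lemma third_coordinate_small (r M c d x y : int) :
    0 < c -> 0 < d -> c <= r -> r < c + d -> r - c < y -> M < (r + 1) * (r + 1) ->
    y * d + x * c = M ->
  x - y <= r.
Proof.
move=> c0 d0 cr cd ry rM E; rewrite leNgt; apply/negP => xy.
have h1 : (c + d) * y >= (r + 1) * (r - c + 1) by clear -cd ry c0 cr; nia.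
have h2 : c * (x - y) >= c * (r + 1) by clear -c0 xy; nia.
have : M = c * (x - y) + (c + d) * y by rewrite -E; ring.
by clear -h1 h2 rM; lia.
Qed.

Lemma sqr_bound (r a s : nat) : (r < s)%N -> (a * s < r.+1 * r.+1)%N -> (a <= r)%N.
Proof.
move=> rs; apply: contraTT; rewrite -!leqNgt -ltnNge => ra.
by rewrite leq_mul.
Qed.

(** * Farey fractions *)

Definition unimodular : rel rat :=
  [rel x y | numq y * denq x - numq x * denq y == 1].

Lemma ltq_cross (x y : rat) : (x < y) = (numq x * denq y < numq y * denq x).
Proof. exact: lt_ratE. Qed.

Lemma leq_cross (x y : rat) : (x <= y) = (numq x * denq y <= numq y * denq x).
Proof. exact: le_ratE. Qed.

Lemma unimodular_lt (x y : rat) : unimodular x y -> x < y.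
Proof. by move=> /eqP xy; rewrite ltq_cross -subr_gt0 xy. Qed.

Definition mediant (x y : rat) : rat :=
  (numq x + numq y)%:~R / (denq x + denq y)%:~R.

Lemma mediantP (x y : rat) : unimodular x y ->
  [/\ unimodular x (mediant x y), unimodular (mediant x y) y &
      denq (mediant x y) = denq x + denq y].
Proof.
move=> /eqP xy.
have co : coprime (absz (numq x + numq y)) (absz (denq x + denq y)).
  rewrite -coprimezE; apply/coprimezP; exists (denq x, - numq x) => /=.
  by rewrite -xy; ring.
have d_gt0 : 0 < denq x + denq y by rewrite addr_gt0 ?denq_gt0.
have nE : numq (mediant x y) = numq x + numq y.
  by rewrite /mediant coprimeq_num // gtr0_sg // mul1r.
have dE : denq (mediant x y) = denq x + denq y.
  by rewrite /mediant coprimeq_den // gt_eqF // gtr0_norm.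
by split=> //; apply/eqP; rewrite nE dE -xy; ring.
Qed.

Definition den (x : rat) : nat := `|denq x|%N.

Lemma den_mediant (x y : rat) : unimodular x y -> den (mediant x y) = (den x + den y)%N.
Proof.
move=> /mediantP[_ _ E]; apply/eqP; rewrite -eqz_nat PoszD /den.
by rewrite !gtz0_abs ?denq_gt0 // E.
Qed.

Lemma farey_fractions_of s : farey_sequence s ->
  exists L : seq rat, [/\ map den L = s, sorted unimodular L,
    head 1 L = 0 & last 0 L = 1].
Proof.
elim=> [|s1 s2 a b _ [L [EL sL hL lL]]]; first by exists [:: 0; 1].
have EL1 := congr1 (take (size s1)) EL; have EL2 := congr1 (drop (size s1)) EL.
rewrite take_size_cat // -map_take in EL1; rewrite drop_size_cat // -map_drop in EL2.
move: EL2 EL1 sL hL lL; rewrite -[in sorted _ _](cat_take_drop (size s1) L).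
rewrite -[in head _ _](cat_take_drop (size s1) L) -[in last _ _](cat_take_drop (size s1) L).
move: (take _ L) (drop _ L) => L1 [|x [|y L2]] //= [<- <- <-] <-.
rewrite sorted_cat_cons /= => /and3P[sL1 uxy pL2] hL lL.
have [u1 u2 _] := mediantP _ _ uxy.
exists (L1 ++ [:: x, mediant x y, y & L2]); split.
- by rewrite map_cat /= den_mediant.
- by rewrite sorted_cat_cons /= sL1 u1 u2 pL2.
- by case: (L1) hL.
by move: lL; rewrite !last_cat.
Qed.

(* A fraction strictly between two neighbours is a positive integer combination
   of them, so its denominator is at least the sum of theirs. *)
Lemma den_between (x y z : rat) : unimodular y z -> y < x -> x < z ->
  (den y + den z <= den x)%N.
Proof.
move=> /eqP yz; rewrite !ltq_cross => yx xz.
rewrite -lez_nat PoszD /den !gtz0_abs ?denq_gt0 //.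
have -> : denq x = denq y * (numq z * denq x - numq x * denq z) +
    denq z * (numq x * denq y - numq y * denq x).
  by rewrite -[LHS]mulr1 -yz; ring.
have dx u : 0 <= denq u by apply/ltW/denq_gt0.
by rewrite lerD // ler_peMr // -gtz0_ge1 subr_gt0.
Qed.

Lemma path_bracket (x y : rat) L : path unimodular y L -> y <= x -> x <= last y L ->
  x \in y :: L \/ exists u v, [/\ u < x, x < v, unimodular u v &
                                 (den u, den v) \in sides (map den (y :: L))].
Proof.
elim: L y => [|z L IH] y /=.
  by move=> _ yx xy; left; rewrite inE eq_le yx xy.
move=> /andP[yz zL] yx xl; have [xz|zx] := ltP x z.
  move: yx; rewrite le_eqVlt => /predU1P[->|yx]; first by left; rewrite mem_head.
  by right; exists y, z; split=> //; rewrite /sides /= mem_head.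
have [xL|[u [v [h1 h2 h3 h4]]]] := IH z zL zx xl.
  by left; rewrite inE xL orbT.
by right; exists u, v; split=> //; rewrite /sides /= inE h4 orbT.
Qed.

Lemma path_le_last (x y : rat) L : path <%R y L -> x \in y :: L -> x <= last y L.
Proof.
elim: L x y => [|z L IH] x y /=; first by rewrite inE => _ /eqP->.
move=> /andP[yz zL]; rewrite inE => /predU1P[->|xL]; last exact: IH.
by apply: le_trans (ltW yz) _; apply: IH; rewrite ?mem_head.
Qed.

Lemma mem_farey_fractions r x : (x \in farey_fractions r) =
  [&& 0 <= x, x <= 1 & (den x <= r)%N].
Proof.
rewrite mem_sort mem_undup; apply/allpairsPdep/and3P.
  move=> [b [a [br ab ->]]]; rewrite !mem_iota /= in br ab.
  have /andP[b0 br'] := br; rewrite add0n ltnS in ab; rewrite add1n ltnS in br'.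
  have b0' : 0 < (b%:R : rat) by rewrite ltr0n.
  split; first by rewrite divr_ge0 ?ler0n.
    by rewrite ler_pdivrMr // mul1r ler_nat.
  apply: leq_trans br'; apply: dvdn_leq => //.
  set y := _ / _; have yb : numq y * b%:Z = a%:Z * denq y.
    apply: (@intr_inj rat); rewrite !rmorphM /=.
    have b_neq0 : b%:Z != 0 by rewrite eqz_nat -lt0n.
    apply/eqP; rewrite -eqr_div ?intr_eq0 ?denq_neq0 //.
    by rewrite divq_num_den.
  have : (denq y %| numq y * b%:Z)%Z by rewrite yb dvdz_mull.
  rewrite Gauss_dvdzr; first by rewrite dvdzE.
  by rewrite coprimezE coprime_sym coprime_num_den.
move=> [x0 x1 xr].
exists (den x), `|numq x|%N; split.
- by rewrite mem_iota add1n ltnS xr andbT absz_gt0 denq_neq0.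
- rewrite mem_iota add0n ltnS /=.
  rewrite -lez_nat /den gez0_abs ?numq_ge0 // gtz0_abs ?denq_gt0 //.
  by move: x1; rewrite leq_cross mulr1 mul1r.
rewrite !natr_absz ger0_norm ?numq_ge0 // gtr0_norm ?denq_gt0 //.
by rewrite divq_num_den.
Qed.

(** Both lists of fractions are strictly increasing, so only their members matter. A missing
    fraction of denominator at most [r] would lie between two neighbours, hence have denominator at
    least their sum, which exceeds [r]. *)
Lemma farey_denominatorsE r s : farey_sequence s ->
    (forall e, e \in s -> (e <= r)%N) ->
    (forall t, t \in sides s -> (r < t.1 + t.2)%N) ->
  s = farey_denominators r.
Proof.
move=> /farey_fractions_of[L [<- sL hL lL]] Lr Lsum.
congr (map _ _); apply: lt_sorted_eq.
- exact: sub_sorted unimodular_lt _ sL.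
- by rewrite sort_lt_sorted undup_uniq.
have [L' EL] : exists L', L = 0 :: L'.
  case: L hL {sL Lr Lsum lL} => [/eqP|y L' /= ->]; first by rewrite oner_eq0.
  by exists L'.
move: sL lL Lr Lsum; rewrite {}EL /= => pL lL Lr Lsum x.
have ltL : path <%R 0 L' by apply: sub_path unimodular_lt _ _ pL.
rewrite mem_farey_fractions; apply/idP/and3P => [xL|[x0 x1 xr]].
  split; last by apply: Lr; apply: (map_f den xL).
    move: xL; rewrite inE => /predU1P[->//|xL].
    by apply: ltW; have /(order_path_min lt_trans)/allP := ltL; apply.
  by rewrite -lL; exact: path_le_last.
rewrite -lL in x1; have [//|[u [v [ux xv uv]]]] := path_bracket x 0 L' pL x0 x1.
by move=> /Lsum /=; rewrite ltnNge (leq_trans (den_between _ _ _ uv ux xv)).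
Qed.

(** * The projective line over Z/p^n *)

Section Gamma0Farey.

Variables (p n : nat).
Hypotheses (prime_p : prime p) (p_gt2 : (2 < p)%N) (n_gt1 : (1 < n)%N).

Local Notation N := (p ^ n)%N.

Let n_gt0 : (0 < n)%N := ltnW n_gt1.

Definition nonp (u : int * int) :=
  ~~ ((p%:Z %| u.1)%Z && (p%:Z %| u.2)%Z).

Lemma euclidz (a b : int) :
  (p%:Z %| a * b)%Z = (p%:Z %| a)%Z || (p%:Z %| b)%Z.
Proof. by rewrite !dvdzE abszM Euclid_dvdM. Qed.

Lemma coprimez_pX m (a : int) : ~~ (p%:Z %| a)%Z -> coprimez (p ^ m)%N%:Z a.
Proof. by move=> pa; rewrite coprimezE /= coprimeXl // prime_coprime. Qed.

Lemma nonp_rot u : nonp (rot u) = nonp u.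
Proof. by rewrite /nonp /= andbC rpredN. Qed.

Lemma nonp_tau u : nonp (tau u) = nonp u.
Proof.
rewrite /nonp /= andbC; case: (boolP (p%:Z %| u.2)%Z) => pu; last by rewrite !andbF.
by rewrite !andbT rpredN rpredDr.
Qed.

Lemma dvdzX_cancel m u (d : int) : nonp u ->
    ((p ^ m)%N%:Z %| u.1 * d)%Z -> ((p ^ m)%N%:Z %| u.2 * d)%Z ->
  ((p ^ m)%N%:Z %| d)%Z.
Proof.
by rewrite /nonp negb_and => /orP[] /(coprimez_pX m) pu; rewrite !(Gauss_dvdzr _ pu).
Qed.

(** Each entry of [v] times [cross u w] is a combination of the other two determinants, and one
    entry of [v] is a unit modulo N. This is transitivity of equality in P^1(Z/N). *)
Lemma cross_dvdz_trans u v w : nonp v ->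
  (N%:Z %| cross u v)%Z -> (N%:Z %| cross v w)%Z -> (N%:Z %| cross u w)%Z.
Proof.
move=> npv uv vw; apply: (dvdzX_cancel _ _ _ npv).
  have -> : v.1 * cross u w = u.1 * cross v w + w.1 * cross u v.
    by rewrite /cross; ring.
  by rewrite rpredD ?dvdz_mull.
have -> : v.2 * cross u w = u.2 * cross v w + w.2 * cross u v.
  by rewrite /cross; ring.
by rewrite rpredD ?dvdz_mull.
Qed.

Lemma cross_dvdzC u v : (N%:Z %| cross u v)%Z = (N%:Z %| cross v u)%Z.
Proof.
have -> : cross v u = - cross u v by rewrite /cross; ring.
by rewrite rpredN.
Qed.

(* The points (i : 1), then the points (1 : p j). *)
Definition P1 := ('I_N + 'I_(p ^ n.-1))%type.

Definition rep (v : P1) : int * int :=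
  match v with
  | inl i => (i%:Z, 1)
  | inr j => (1, p%:Z * j%:Z)
  end.

Lemma rep_nonp v : nonp (rep v).
Proof.
have p1 : ~~ (p%:Z %| 1)%Z.
  by rewrite dvdzE /= dvdn1; apply: contraTneq prime_p => ->.
by case: v => i; rewrite /nonp /= negb_and p1 ?orbT.
Qed.

Lemma pN_expn : (p ^ n = p * p ^ n.-1)%N.
Proof. by rewrite -expnS prednK. Qed.

Lemma rep_cross_inj v w : (N%:Z %| cross (rep v) (rep w))%Z -> v = w.
Proof.
have N_gt0 : (0 < N)%N by rewrite expn_gt0 prime_gt0.
have ntriv i j : (N%:Z %| i * (p%:Z * j) - 1)%Z -> False.
  move=> d; have : (p%:Z %| i * (p%:Z * j) - 1)%Z.
    by apply: dvdz_trans d; rewrite dvdzE /= dvdn_exp.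
  rewrite rpredBl; last by rewrite mulrCA dvdz_mulr.
  by rewrite dvdzE /= dvdn1; case: eqP prime_p => [->|].
case: v => i; case: w => j /=; rewrite /cross /= ?mul1r ?mulr1.
- by move=> /ltn_dvdz_eq E; congr inl; apply/val_inj/E.
- by move/ntriv.
- by rewrite -rpredN opprB mulrC => /ntriv.
move=> d; rewrite pN_expn PoszM -mulrBr dvdz_mul2l in d; last first.
  by have := prime_gt0 prime_p; case: (p).
by rewrite -rpredN opprB in d; congr inr; apply/val_inj/(ltn_dvdz_eq _ _ _ _ _ d).
Qed.

Lemma rep_cover u : nonp u -> exists v, (N%:Z %| cross u (rep v))%Z.
Proof.
have N_gt0 : (0 < N)%N by rewrite expn_gt0 prime_gt0.
have N_neq0 : N%:Z != 0 by case: (N) N_gt0.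
case: u => a b npu; case: (boolP (p%:Z %| b)%Z) => pb; last first.
  have [c bc] := coprimez_inv _ _ N_gt0 (coprimez_pX _ _ pb).
  have im : (absz ((a * c%:Z)%R %% N)%Z < N)%N.
    by rewrite -ltz_nat gez0_abs ?modz_ge0 // ltz_pmod.
  exists (inl (Ordinal im)); rewrite /cross /= gez0_abs ?modz_ge0 //.
  have /dvdzP[q E] := bc; apply/dvdzP.
  exists (b * ((a * c%:Z)%R %/ N)%Z - a * q).
  have := divz_eq (a * c%:Z)%R N; set d := (_ %/ _)%Z; set e := (_ %% _)%Z.
  move=> E2; have -> : e = a * c%:Z - d * N by rewrite E2; ring.
  move: (N%:Z) E => Nz E; have -> : a * 1 - b * (a * c%:Z - d * Nz) =
    - a * (b * c%:Z - 1) + b * d * Nz by ring.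
  by rewrite E; ring.
have pa : ~~ (p%:Z %| a)%Z by move: npu; rewrite /nonp /= pb andbT.
have [c bc] := coprimez_inv _ _ N_gt0 (coprimez_pX _ _ pa).
have /dvdzP[b' Eb] := pb.
have M_gt0 : (0 < p ^ n.-1)%N by rewrite expn_gt0 prime_gt0.
have M_neq0 : (p ^ n.-1)%N%:Z != 0 by case: (p ^ n.-1)%N M_gt0.
have im : (absz ((b' * c%:Z)%R %% (p ^ n.-1)%N)%Z < p ^ n.-1)%N.
  by rewrite -ltz_nat gez0_abs ?modz_ge0 // ltz_pmod.
exists (inr (Ordinal im)); rewrite /cross /= gez0_abs ?modz_ge0 //.
have /dvdzP[q E] := bc; apply/dvdzP.
exists (b * q - a * ((b' * c%:Z)%R %/ (p ^ n.-1)%N)%Z).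
have := divz_eq (b' * c%:Z)%R (p ^ n.-1)%N; set d := (_ %/ _)%Z; set e := (_ %% _)%Z.
move=> E2; have -> : e = b' * c%:Z - d * (p ^ n.-1)%N by rewrite E2; ring.
have NE : N%:Z = p%:Z * (p ^ n.-1)%N by rewrite pN_expn.
move: E; rewrite NE; move: (p ^ n.-1)%N%:Z (c%:Z) (d) (e) E2 => M c' d' e' E2 E.
have -> : a * (p%:Z * (b' * c' - d' * M)) - b * 1 =
   b * (a * c' - 1) - a * d' * (p%:Z * M) by rewrite Eb; ring.
by rewrite E; ring.
Qed.

Lemma P1_point : 'I_N.
Proof. by apply: (@Ordinal _ 0); rewrite expn_gt0 prime_gt0. Qed.

(** The default is returned only for vectors divisible by p, whose class has no meaning. *)
Definition cls (u : int * int) : P1 :=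
  odflt (inl P1_point) [pick v | (N%:Z %| cross u (rep v))%Z].

Lemma cls_cross u : nonp u -> (N%:Z %| cross u (rep (cls u)))%Z.
Proof.
move=> npu; rewrite /cls; case: pickP => [v //|nov].
by have [v] := rep_cover _ npu; rewrite nov.
Qed.

Lemma eq_cls u v : nonp u -> nonp v ->
  (cls u == cls v) = (N%:Z %| cross u v)%Z.
Proof.
move=> npu npv; have uu := cls_cross _ npu; have vv := cls_cross _ npv.
apply/eqP/idP => [E|uv].
  rewrite E in uu; apply: cross_dvdz_trans uu _; first exact: rep_nonp.
  by rewrite cross_dvdzC.
apply: rep_cross_inj; apply: (cross_dvdz_trans _ v) => //.
by rewrite cross_dvdzC in uu; exact: cross_dvdz_trans uu uv.
Qed.

Lemma repK v : cls (rep v) = v.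
Proof.
by apply/esym/rep_cross_inj/cls_cross/rep_nonp.
Qed.

(* [sg] reverses an oriented edge; [ta] moves to the next edge of its triangle. *)
Definition sg v := cls (rot (rep v)).
Definition ta v := cls (tau (rep v)).

Lemma sg_cls u : nonp u -> sg (cls u) = cls (rot u).
Proof.
move=> npu; apply/eqP; rewrite eq_cls ?nonp_rot ?rep_nonp // cross_rot.
by rewrite cross_dvdzC cls_cross.
Qed.

Lemma ta_cls u : nonp u -> ta (cls u) = cls (tau u).
Proof.
move=> npu; apply/eqP; rewrite eq_cls ?nonp_tau ?rep_nonp // cross_tau.
by rewrite cross_dvdzC cls_cross.
Qed.

Lemma sgK : involutive sg.
Proof.
move=> v; rewrite -[in LHS](repK v) !sg_cls ?nonp_rot ?rep_nonp //.
rewrite -[RHS]repK; apply/eqP; rewrite eq_cls ?nonp_rot ?rep_nonp //.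
by rewrite /cross /=; have -> : - (rep v).1 * (rep v).2 - - (rep v).2 * (rep v).1 = 0 by ring.
Qed.

Lemma taK v : ta (ta (ta v)) = v.
Proof.
rewrite -[in LHS](repK v) !ta_cls ?nonp_tau ?rep_nonp //.
rewrite -[RHS]repK; congr cls; rewrite /tau /=.
by apply: injective_projections => /=; ring.
Qed.

Lemma fix_cls u : nonp u ->
  (ta (cls u) == cls u) = (N%:Z %| u.1 ^+ 2 + u.1 * u.2 + u.2 ^+ 2)%Z.
Proof.
move=> npu; rewrite ta_cls // eq_cls ?nonp_tau //; congr (_ %| _)%Z.
by rewrite /cross /=; ring.
Qed.

Local Opaque cls sg ta.

(** * The index of Gamma_0(p^n) *)

Local Open Scope quotient_scope.

Definition mx2 (a b c d : int) : 'M[int]_2 :=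
  \matrix_(i, j) if i == 0 then (if j == 0 then a else b)
                 else (if j == 0 then c else d).

Lemma det_mx2 a b c d : \det (mx2 a b c d) = a * d - b * c.
Proof.
rewrite (expand_det_row _ 0) !big_ord_recl big_ord0 addr0 /cofactor !det_mx11.
by rewrite !mxE /= expr0 mul1r expr1 mulN1r mulrN.
Qed.

Lemma det_entries (A : 'M[int]_2) : \det A = A 0 0 * A 1 1 - A 0 1 * A 1 0.
Proof.
suff {1}-> : A = mx2 (A 0 0) (A 0 1) (A 1 0) (A 1 1) by rewrite det_mx2.
by apply/matrixP => i j; rewrite mxE; case: i => [[|[|?]] ?] //; case: j => [[|[|?]] ?] //=;
  congr (A _ _); apply: val_inj.
Qed.

Lemma mulmx2E (A B : 'M[int]_2) i j : (A *m B) i j = A i 0 * B 0 j + A i 1 * B 1 j.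
Proof.
rewrite mxE !big_ord_recl big_ord0 addr0.
by congr (A _ _ * B _ _ + A _ _ * B _ _); apply: val_inj.
Qed.

Definition col0 (A : SL2Z) : int * int := (val A 0 0, val A 1 0).

Lemma SL2Z_det (A : SL2Z) : val A 0 0 * val A 1 1 - val A 0 1 * val A 1 0 = 1.
Proof. by rewrite -det_entries det_SL2Z. Qed.

Lemma nonp_col0 A : nonp (col0 A).
Proof.
apply/negP => /andP[h1 h2]; have : (p%:Z %| 1%R)%Z.
  by rewrite -(SL2Z_det A) rpredB ?(dvdz_mulr _ h1) ?(dvdz_mull _ h2).
by rewrite dvdzE /= dvdn1; case: eqP prime_p => [->|].
Qed.

Definition PSL2Z_coset (x : PSL2Z) : set PSL2Z :=
  [set (x * h)%g | h in Gamma0 N]%classic.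

(** The first column of an element of Gamma_0(N) is [(a, 0)] modulo N, so right multiplication by it
    only rescales first columns modulo N: left cosets are points of P^1(Z/N). *)
Lemma coset_sub (A B : SL2Z) : (N%:Z %| cross (col0 A) (col0 B))%Z ->
  (PSL2Z_coset (\pi_PSL2Z A) `<=` PSL2Z_coset (\pi_PSL2Z B))%classic.
Proof.
move=> d _ [_ [C /= C10 <-] <-].
have [X EX] : exists X : SL2Z, (B * X = A * C)%g.
  by exists (B^-1 * (A * C))%g; rewrite mulVKg.
have BX : val B *m val X = val A *m val C := congr1 val EX.
exists (\pi_PSL2Z X); last first.
  rewrite [LHS]pi_PSL2Z_mul [RHS]pi_PSL2Z_mul; by rewrite EX.
exists X => //=.
(* This is the lower left entry of [B^-1 * A * C]. *)
have -> : val X 1 0 = val C 0 0 * (- cross (col0 A) (col0 B)) +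
    (val B 0 0 * val A 1 1 - val B 1 0 * val A 0 1) * val C 1 0.
  have E10 := congr1 (fun M : 'M[int]_2 => M 1 0) BX.
  have E00 := congr1 (fun M : 'M[int]_2 => M 0 0) BX.
  rewrite !mulmx2E in E10 E00.
  transitivity ((val B 0 0 * val B 1 1 - val B 0 1 * val B 1 0) * val X 1 0).
    by rewrite SL2Z_det mul1r.
  transitivity (val B 0 0 * (val B 1 0 * val X 0 0 + val B 1 1 * val X 1 0) -
    val B 1 0 * (val B 0 0 * val X 0 0 + val B 0 1 * val X 1 0)); first by ring.
  by rewrite E10 E00 /cross /col0 /=; ring.
by rewrite rpredD ?(dvdz_mull _ C10) // dvdz_mull // rpredN.
Qed.

Lemma eq_coset (A B : SL2Z) :
  PSL2Z_coset (\pi_PSL2Z A) = PSL2Z_coset (\pi_PSL2Z B) <->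
  (N%:Z %| cross (col0 A) (col0 B))%Z.
Proof.
split=> [E|d]; last first.
  by apply/seteqP; split; apply: coset_sub; rewrite // cross_dvdzC.
have : PSL2Z_coset (\pi_PSL2Z A) (\pi_PSL2Z A).
  exists 1%g; last by rewrite mulg1.
  by exists 1%g => //=; rewrite mxE.
rewrite E => -[_ [C /= C10 <-]].
rewrite [LHS]pi_PSL2Z_mul => /eqmodP/orP[]/eqP /= BC.
  have E10 := congr1 (fun M : 'M[int]_2 => M 1 0) BC.
  have E00 := congr1 (fun M : 'M[int]_2 => M 0 0) BC.
  rewrite !mulmx2E in E10 E00.
  have -> : cross (col0 A) (col0 B) =
      - (val B 0 0 * val B 1 1 - val B 0 1 * val B 1 0) * val C 1 0.
    by rewrite /cross /col0 /= -E10 -E00; ring.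
  by rewrite dvdz_mull.
have E10 := congr1 (fun M : 'M[int]_2 => M 1 0) BC.
have E00 := congr1 (fun M : 'M[int]_2 => M 0 0) BC.
rewrite /= !mulmx2E !mxE in E10 E00.
have -> : cross (col0 A) (col0 B) =
    (val B 0 0 * val B 1 1 - val B 0 1 * val B 1 0) * val C 1 0.
  have {}E10 : val A 1 0 = - (val B 1 0 * val C 0 0 + val B 1 1 * val C 1 0).
    by rewrite E10 opprK.
  have {}E00 : val A 0 0 = - (val B 0 0 * val C 0 0 + val B 0 1 * val C 1 0).
    by rewrite E00 opprK.
  by rewrite /cross /col0 /= E10 E00; ring.
by rewrite dvdz_mull.
Qed.

Lemma coset_rep_subproof (v : P1) : \det (match v with
    | inl i => mx2 i%:Z (-1) 1 0
    | inr j => mx2 1 0 (p%:Z * j%:Z) 1 end) == 1.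
Proof. by case: v => i; rewrite det_mx2; apply/eqP; ring. Qed.

Definition coset_rep (v : P1) : SL2Z := MkSL2Z (coset_rep_subproof v).

Lemma col0_coset_rep v : col0 (coset_rep v) = rep v.
Proof. by case: v => i; rewrite /col0 /= !mxE. Qed.

Lemma index_Gamma0 : has_index (Gamma0 N) #|{: P1}|.
Proof.
rewrite /has_index.
have -> : left_cosets (Gamma0 N) =
    [set PSL2Z_coset (\pi_PSL2Z (coset_rep v)) | v in [set: P1]]%classic.
  apply/seteqP; split=> [_ [g _ <-]|_ [v _ <-]]; last by exists (\pi_PSL2Z (coset_rep v)).
  rewrite -(reprK g); exists (cls (col0 (repr g))) => //.
  apply/eq_coset; rewrite col0_coset_rep cross_dvdzC; apply: cls_cross.
  exact: nonp_col0.
have -> : `I_#|{: P1}|%classic = [set nat_of_ord (enum_rank v) | v in [set: P1]]%classic.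
  apply/seteqP; split=> [i /= ilt|_ [v _ <-]] /=; last exact: ltn_ord.
  by exists (enum_val (Ordinal ilt)) => //; rewrite enum_valK.
apply: (card_eq_trans (B := [set: P1]%classic)).
  apply: inj_card_eq.
  move=> v w _ _ /eq_coset; rewrite !col0_coset_rep; exact: rep_cross_inj.
rewrite card_eq_sym; apply: inj_card_eq => v w _ _ h.
by apply/enum_rank_inj/val_inj.
Qed.

Local Close Scope quotient_scope.

(** * Farey sequences with inequivalent triangles *)

Definition scls (t : nat * nat) : P1 := cls (t.1%:Z, t.2%:Z).

(* [scls t] is the side [t] seen from the triangle outside the Farey polygon, and
   [sg (scls t)] is [t] seen from the inside. [J] collects the classes of the oriented
   edges interior to the polygon, so [used] are the edges of all its triangles. *)
Definition used (F : seq nat) (J : {set P1}) (v : P1) :=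
  (v \in J) || (v \in [seq sg (scls t) | t <- sides F]).

(* [D] lists the sides at which a mediant has been inserted. *)
Record state (F : seq nat) (J : {set P1}) (D : seq (nat * nat)) : Prop := {
  st_farey : farey_sequence F;
  st_side : forall t, t \in sides F ->
    [/\ (0 < t.1)%N, (0 < t.2)%N & coprime t.1 t.2];
  st_uniq : uniq [seq sg (scls t) | t <- sides F];
  st_sg : forall v, v \in J -> sg v \in J;
  st_disj : forall t, t \in sides F -> sg (scls t) \notin J;
  st_ta : forall v, used F J v -> used F J (ta v);
  st_nofix : forall v, used F J v -> ta v != v;
  st_card : #|J| = (2 * size (sides F))%N;
  st_size : size F = (size (sides F)).+1;
  st_root : (1%N, 1%N) \in sides F ++ D;
  st_children : forall t, t \in D ->
    ((t.1, t.1 + t.2)%N \in sides F ++ D) /\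
    ((t.1 + t.2, t.2)%N \in sides F ++ D);
  st_inserted : forall t, t \in D -> scls t \in J }.

Lemma p_dvdz1 : (p%:Z %| 1)%Z = false.
Proof. by rewrite dvdzE /= dvdn1; case: eqP prime_p => [->|]. Qed.

Lemma N_dvdz1 : (N%:Z %| 1)%Z = false.
Proof.
rewrite dvdzE /= dvdn1 -(expn0 p) eqn_exp2l ?prime_gt1 //.
by case: (n) n_gt0.
Qed.

Lemma nonp_coprime (t : nat * nat) : coprime t.1 t.2 -> nonp (t.1%:Z, t.2%:Z).
Proof.
move=> co; rewrite /nonp !dvdzE /=; apply/negP => pt.
have : (p %| gcdn t.1 t.2)%N by rewrite dvdn_gcd.
by rewrite (eqP co) dvdn1; case: eqP prime_p => [->|].
Qed.

Lemma cls_opp u : nonp u -> cls (- u.1, - u.2) = cls u.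
Proof.
move=> npu; apply/eqP; rewrite eq_cls //; last by rewrite /nonp /= !rpredN.
by have -> : cross (- u.1, - u.2) u = 0 by rewrite /cross /=; ring.
Qed.

(** The side (1, 1) bounds the triangle 0, 1, infinity, whose two vertical edges are identified by
    translation and so count as interior. *)
Lemma initial_state :
  state [:: 1%N; 1%N] [set cls (0, 1); cls (1, 0)] [::].
Proof.
have np01 : nonp (0, 1) by rewrite /nonp /= p_dvdz1 andbF.
have np10 : nonp (1, 0) by rewrite /nonp /= p_dvdz1.
have np11 : nonp (1, -1) by rewrite /nonp /= p_dvdz1.
have np1 : nonp (1, 1) by rewrite /nonp /= p_dvdz1.
have sg1 : sg (scls (1%N, 1%N)) = cls (1, -1) by rewrite /scls sg_cls.
have sg01 : sg (cls (0, 1)) = cls (1, 0) by rewrite sg_cls // /rot /= oppr0.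
have sg10 : sg (cls (1, 0)) = cls (0, 1).
  by rewrite -sg01 sgK.
have ta01 : ta (cls (0, 1)) = cls (1, -1) by rewrite ta_cls.
have ta11 : ta (cls (1, -1)) = cls (1, 0).
  by rewrite ta_cls // /tau /= subrr -[RHS]cls_opp //= oppr0.
have ta10 : ta (cls (1, 0)) = cls (0, 1).
  by rewrite ta_cls // /tau /= addr0 -[RHS]cls_opp //= oppr0.
have ne1 : cls (0, 1) != cls (1, -1).
  by rewrite eq_cls // /cross /= mul0r mulr1 sub0r rpredN N_dvdz1.
have ne2 : cls (1, 0) != cls (0, 1).
  by rewrite eq_cls // /cross /= mul0r mulr1 subr0 N_dvdz1.
have ne3 : cls (1, -1) != cls (1, 0).
  by rewrite eq_cls // /cross /= !mulr1 mulr0 sub0r opprK N_dvdz1.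
have usedE v : used [:: 1%N; 1%N] [set cls (0, 1); cls (1, 0)] v =
    [|| v == cls (0, 1), v == cls (1, 0) | v == cls (1, -1)].
  by rewrite /used /= !inE sg1 orbA.
split=> //.
- exact: mediant_insertions_refl.
- by move=> t; rewrite !inE => /eqP->.
- by move=> v; rewrite !inE => /orP[]/eqP->; rewrite ?sg01 ?sg10 eqxx ?orbT.
- move=> t; rewrite !inE => /eqP->.
  by rewrite sg1 negb_or eq_sym ne1 ne3.
- by move=> v; rewrite !usedE => /or3P[]/eqP->;
    rewrite ?ta01 ?ta10 ?ta11 eqxx ?orbT.
- by move=> v; rewrite !usedE => /or3P[]/eqP->;
    rewrite ?ta01 ?ta10 ?ta11 eq_sym ?ne1 ?ne2 ?ne3.
- by rewrite cards2 eq_sym ne2.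
Qed.

Lemma sides_insert s1 a b s2 :
  sides (s1 ++ [:: a, b & s2]) =
    sides (rcons s1 a) ++ (a, b) :: sides (b :: s2).
Proof. by rewrite sides_cat. Qed.

Lemma sg_left_child a b : coprime a b ->
  sg (scls (a, a + b)%N) = ta (ta (scls (a, b))).
Proof.
move=> co; have npab := nonp_coprime (a, b) co.
have npc : nonp (a%:Z, (a + b)%N%:Z).
  by apply: (nonp_coprime (a, a + b)%N); rewrite /= /coprime gcdnDl.
rewrite /scls sg_cls // !ta_cls ?nonp_tau // -[RHS]cls_opp ?nonp_tau //=.
by congr cls; apply: injective_projections => /=; rewrite ?PoszD; ring.
Qed.

Lemma sg_right_child a b : coprime a b ->
  sg (scls (a + b, b)%N) = ta (scls (a, b)).
Proof.
move=> co; have npab := nonp_coprime (a, b) co.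
have npc : nonp ((a + b)%N%:Z, b%:Z).
  apply: (nonp_coprime (a + b, b)%N).
  by rewrite /= coprime_sym /coprime gcdnDr gcdnC.
by rewrite /scls sg_cls ?ta_cls.
Qed.

Lemma insert_state s1 a b s2 J D :
    state (s1 ++ [:: a, b & s2]) J D ->
    ~~ used (s1 ++ [:: a, b & s2]) J (scls (a, b)) ->
    ta (scls (a, b)) != scls (a, b) ->
  state (s1 ++ [:: a, (a + b)%N, b & s2])
    (scls (a, b) |: (sg (scls (a, b)) |: J)) ((a, b) :: D).
Proof.
set F := s1 ++ _; set F' := s1 ++ _; set c := scls _; set J' := _ |: _.
move=> st nused nfix; have sF : sides F = _ := sides_insert _ _ _ _.
have sF' : sides F' = sides (rcons s1 a) ++
   [:: (a, a + b), (a + b, b) & sides (b :: s2)]%N by rewrite /F' sides_cat.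
have zF : size (sides F') = (size (sides F)).+1.
  by rewrite sF sF' !size_cat /= !addnS.
have tF : (a, b) \in sides F by rewrite sF mem_cat mem_head orbT.
have [/= a0 b0 coab] := st_side _ _ _ st _ tF.
have co1 : coprime a (a + b) by rewrite /coprime gcdnDl.
have co2 : coprime (a + b) b by rewrite coprime_sym /coprime gcdnDr gcdnC.
have in1 : sg (scls (a, a + b)%N) = ta (ta c) by rewrite sg_left_child.
have in2 : sg (scls (a + b, b)%N) = ta c by rewrite sg_right_child.
have nused1 : ~~ used F J (ta c).
  by apply: contra nused => /(st_ta _ _ _ st)/(st_ta _ _ _ st); rewrite taK.
have nused2 : ~~ used F J (ta (ta c)).
  by apply: contra nused => /(st_ta _ _ _ st); rewrite taK.
have nfix1 : ta (ta c) != ta c.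
  apply: contra nfix => /eqP h.
  by have := taK c; rewrite !h => ->.
have nfix2 : c != ta (ta c).
  by apply: contra nfix => /eqP/(congr1 ta); rewrite taK // => ->.
have sgJ : sg c \notin J by apply: (st_disj _ _ _ st _ tF).
have sgB : used F J (sg c) by rewrite /used (map_f (fun t => sg (scls t)) tF) orbT.
have sgc : c != sg c by apply: contra nused => /eqP->.
have usedE v : used F' J' v =
    [|| used F J v, v == c, v == ta c | v == ta (ta c)].
  rewrite /used sF sF' !map_cat !mem_cat /= !inE in1 in2 -/c.
  by do !case: (_ == _); do !case: (_ \in _).
have sidesF' t : t \in sides F' ->
    [\/ t \in sides F, t = (a, a + b)%N | t = (a + b, b)%N].
  rewrite sF sF' !mem_cat !inE => /or4P[h|/eqP->|/eqP->|h];
    [constructor 1|constructor 2|constructor 3|constructor 1] => //;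
  by rewrite h ?orbT.
have FDE x : x \in sides F ++ D -> x \in sides F' ++ (a, b) :: D.
  rewrite sF sF' !mem_cat !inE => /orP[/or3P[]|] ->; by rewrite ?orbT.
split.
- exact: mediant_insertions_step (st_farey _ _ _ st).
- move=> t /sidesF'[/(st_side _ _ _ st)//|->|->] /=.
    by rewrite addn_gt0 a0.
  by rewrite addn_gt0 a0 b0.
- have := st_uniq _ _ _ st; rewrite sF sF' !map_cat /= in1 in2 -/c.
  set L := map _ _; set R := map _ _ => uLR.
  have uLR' : uniq (L ++ R).
    by apply: subseq_uniq uLR; rewrite cat_subseq // subseq_cons.
  rewrite -(perm_uniq (s1 := [:: ta (ta c), ta c & L ++ R])).
    have memLR x : x \in L ++ R -> used F J x.
      rewrite /used sF map_cat !mem_cat inE -/L -/R => /orP[]->; by rewrite !orbT.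
    rewrite /= uLR' andbT inE (negbTE nfix1) /=.
    by apply/andP; split; [apply: contra nused2 | apply: contra nused1] => /memLR.
  by rewrite -[_ :: _]cat1s -[ta c :: _]cat1s catA perm_catCA.
- move=> v; rewrite /J' !inE => /or3P[/eqP->|/eqP->|/(st_sg _ _ _ st)->].
  + by rewrite eqxx orbT.
  + by rewrite sgK // eqxx.
  by rewrite !orbT.
- have := st_uniq _ _ _ st; rewrite sF map_cat /= uniq_catC /= mem_cat -/c.
  case/andP=> /norP[sgR sgL] _ t tF'; rewrite sF' mem_cat !inE in tF'.
  have old : (t \in sides (rcons s1 a)) || (t \in sides (b :: s2)) ->
      sg (scls t) \notin J'.
    move=> tLR; have tF1 : t \in sides F.
      by rewrite sF mem_cat inE; case/orP: tLR => ->; rewrite ?orbT.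
    rewrite /J' !inE (negbTE (st_disj _ _ _ st _ tF1)) orbF negb_or.
    apply/andP; split.
      apply: contra nused => /eqP<-.
      by rewrite /used (map_f (fun t => sg (scls t)) tF1) orbT.
    by case/orP: tLR => tLR; [apply: contra sgL | apply: contra sgR] => /eqP<-;
      apply: (map_f (fun t => sg (scls t)) tLR).
  have new v : ~~ used F J v -> c != v -> v \notin J'.
    move=> nv cv; rewrite /J' !inE eq_sym (negbTE cv) /= negb_or.
    by apply/andP; split; [apply: contra nv => /eqP->|apply: contra nv; rewrite /used => ->].
  case/or4P: tF' => [tL|/eqP->|/eqP->|tR]; try by apply: old; rewrite ?tL ?tR ?orbT.
    by rewrite in1 new.
  by rewrite in2 new // eq_sym.
- move=> v; rewrite usedE => /or4P[uv|/eqP->|/eqP->|/eqP->]; rewrite usedE.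
  + by rewrite (st_ta _ _ _ st _ uv).
  + by rewrite [X in [|| _, _, X | _]]eqxx !orbT.
  + by rewrite [X in [|| _, _, _ | X]]eqxx !orbT.
  + by rewrite taK // [X in [|| _, X, _ | _]]eqxx !orbT.
- move=> v; rewrite usedE => /or4P[/(st_nofix _ _ _ st)|/eqP->|/eqP->|/eqP->] //.
  by rewrite taK.
- rewrite /J' !cardsU1 !inE negb_or sgc sgJ.
  have -> : c \notin J by apply: contra nused; rewrite /used => ->.
  by rewrite (st_card _ _ _ st) zF mulnS.
- by rewrite zF -(st_size _ _ _ st) /F /F' !size_cat /= !addnS.
- exact/FDE/(st_root _ _ _ st).
- move=> t; rewrite inE => /predU1P[->|/(st_children _ _ _ st)[/FDE-> /FDE->]] //=.
  by rewrite sF' !mem_cat !inE !eqxx !orbT.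
- move=> t; rewrite /J' !inE => /predU1P[->|/(st_inserted _ _ _ st)->].
    by rewrite eqxx.
  by rewrite !orbT.
Qed.
(** [A] selects the sides open to insertion and [Q] is an invariant. Every insertion enlarges [J]
    inside the finite type [P1], so the process stops. *)
Lemma saturate (A : nat * nat -> Prop) (Q : seq nat -> Prop) F J D :
    (forall s1 a b s2 J D, state (s1 ++ [:: a, b & s2]) J D ->
      Q (s1 ++ [:: a, b & s2]) -> A (a, b) ->
      ~~ used (s1 ++ [:: a, b & s2]) J (scls (a, b)) ->
      Q (s1 ++ [:: a, (a + b)%N, b & s2])) ->
    state F J D -> Q F ->
  exists F' J' D', [/\ state F' J' D', Q F' & forall t, t \in sides F' -> A t ->
    used F' J' (scls t) \/ ta (scls t) = scls t].
Proof.
move=> stepQ; have [m] := ubnP (#|{: P1}| - #|J|)%N.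
elim: m F J D => // m IH F J D; rewrite ltnS => Jm st QF.
have [done|] := pselect (forall t, t \in sides F -> A t ->
    used F J (scls t) \/ ta (scls t) = scls t).
  by exists F, J, D.
move=> /existsNP[[a b] /not_implyP[tF /not_implyP[At /not_orP[/negP nu /eqP nf]]]].
have [s1 [s2 /= EF]] := sides_split _ _ tF.
rewrite EF in tF st QF nu.
have st' := insert_state _ _ _ _ _ _ st nu nf.
apply: (IH _ _ _ _ st'); last exact: stepQ st QF At nu.
have JP : (#|J| < #|{: P1}|)%N.
  rewrite -cardsT; apply: proper_card; rewrite properT.
  by apply: contra nu => /eqP JT; rewrite /used JT inE.
suff : (#|J| < #|scls (a, b) |: (sg (scls (a, b)) |: J)|)%N.
  by move: JP Jm; move: (#|_|) (#|_|) (#|_|) => x y z; clear; lia.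
have cJ : scls (a, b) \notin J by apply: contra nu; rewrite /used => ->.
rewrite cardsU1 !inE negb_or cJ (contra _ nu); last first.
  by move=> /eqP->; rewrite /used (map_f (fun t => sg (scls t)) tF) orbT.
by rewrite add1n ltnS subset_leq_card // subsetU1.
Qed.

(** * Pairing and length once every class is reached *)

Lemma dvdn_pairing t u : coprime t.1 t.2 -> coprime u.1 u.2 ->
  (N %| t.1 * u.1 + t.2 * u.2)%N = (scls t == sg (scls u)).
Proof.
move=> /(nonp_coprime) npt /(nonp_coprime) npu.
rewrite /scls sg_cls // eq_cls ?nonp_rot // -rpredN dvdzE.
by rewrite /cross /= ; congr (_ %| _)%N; lia.
Qed.

Lemma dvdn_fix t : coprime t.1 t.2 ->
  odd_side N t = (ta (scls t) == scls t).
Proof.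
move=> /(nonp_coprime) npt.
by rewrite fix_cls //= dvdzE.
Qed.

(** The outer class of [t] is used but not in [J], which is stable under [sg] and omits the inner
    class of [t]. So it is the inner class of a side [u], other than [t] because [t] is not even,
    and unique because inner classes are distinct. *)
Lemma complete_pairing F J D : state F J D ->
    (forall v, used F J v \/ ta v = v) ->
  forall t, t \in sides F -> ~~ elliptic_side N t ->
    exists! u, u \in sides F /\ paired_sides N t u.
Proof.
move=> st full t tF; have [_ _ cot] := st_side _ _ _ st _ tF.
rewrite negb_or dvdn_fix // => /andP[even_t /eqP ntat].
have pairE u : u \in sides F -> paired_sides N t u = (scls t == sg (scls u)).
  move=> uF; have [_ _ cou] := st_side _ _ _ st _ uF.
  rewrite /paired_sides dvdn_pairing // andbC; case: eqP => //= E.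
  apply: contra even_t => /eqP tu; rewrite -tu in E.
  by move/eqP: E; rewrite -dvdn_pairing.
have [/orP[tJ|/mapP[u uF E]]|//] := full (scls t).
  by move/(st_sg _ _ _ st): tJ; rewrite (negbTE (st_disj _ _ _ st _ tF)).
exists u; split; first by rewrite pairE // E.
move=> w [wF]; rewrite pairE // E => /eqP Euw.
have := st_uniq _ _ _ st; move: uF wF Euw.
elim: (sides F) => // x s IH.
rewrite !inE /= => /predU1P[->|us] /predU1P[->|ws] // E' /andP[xs us'].
- by rewrite E' (map_f (fun t => sg (scls t)) ws) in xs.
- by rewrite -E' (map_f (fun t => sg (scls t)) us) in xs.
exact: IH.
Qed.

Lemma inl_fix (v : P1) : ta v = v ->
  exists2 i : 'I_N, v = inl i & (N%:Z %| i%:Z ^+ 2 + i%:Z + 1)%Z.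
Proof.
move/eqP; rewrite -{1 2}(repK v) fix_cls ?rep_nonp //; case: v => i /=.
  by rewrite mulr1 expr1n => ?; exists i.
move=> d; have : (p%:Z %| 1 ^+ 2 + 1 * (p%:Z * i%:Z) + (p%:Z * i%:Z) ^+ 2)%Z.
  by apply: dvdz_trans d; rewrite dvdzE /= dvdn_exp.
have -> : 1 ^+ 2 + 1 * (p%:Z * i%:Z) + (p%:Z * i%:Z) ^+ 2 =
  1 + p%:Z * (i%:Z + p%:Z * i%:Z ^+ 2) by ring.
by rewrite rpredDr ?dvdz_mulr // p_dvdz1.
Qed.

(** The two values differ by [(i - j) * (i + j + 1)]. If p divided both factors, it would divide
    [2 * i + 1], hence 3; but the polynomial has no root modulo 9. *)
Lemma fix_pair (i j : int) : (N%:Z %| i ^+ 2 + i + 1)%Z ->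
    (N%:Z %| j ^+ 2 + j + 1)%Z ->
  (N%:Z %| i - j)%Z \/ (N%:Z %| i + j + 1)%Z.
Proof.
move=> di dj; have dij : (N%:Z %| (i - j) * (i + j + 1))%Z.
  have -> : (i - j) * (i + j + 1) = (i ^+ 2 + i + 1) - (j ^+ 2 + j + 1) by ring.
  by rewrite rpredB.
have [pij|] := boolP (p%:Z %| i - j)%Z; last first.
  by move=> /(coprimez_pX n) co; rewrite Gauss_dvdzr // in dij; right.
have [pij'|] := boolP (p%:Z %| i + j + 1)%Z; last first.
  by move=> /(coprimez_pX n) co; rewrite Gauss_dvdzl // in dij; left.
have p2i : (p%:Z %| i *+ 2 + 1)%Z.
  have -> : i *+ 2 + 1 = (i - j) + (i + j + 1) by ring.
  by rewrite rpredD.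
have p2d : (p%:Z ^+ 2 %| i ^+ 2 + i + 1)%Z.
  apply: dvdz_trans di; rewrite expr2 -PoszM mulnn dvdzE /=.
  by rewrite dvdn_exp2l.
have p3 : (p%:Z %| 3%:Z)%Z.
  have -> : 3%:Z = 4 * (i ^+ 2 + i + 1) - (i *+ 2 + 1) ^+ 2 by ring.
  rewrite rpredB ?dvdz_mull ?expr2 ?dvdz_mulr //.
  by apply: dvdz_trans p2d; rewrite expr2 dvdz_mulr.
have p_eq3 : p = 3%N.
  move: p3; rewrite dvdzE /= => /dvdn_leq; move=> /(_ isT); lia.
move: p2i p2d; rewrite p_eq3 => /dvdzP[q Eq] /dvdzP[q' Eq'].
have E : 4 * (q' * 3 ^+ 2) = (q * 3) ^+ 2 + 3 by rewrite -Eq' -Eq; ring.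
have : 36 * q' = 9 * (q * q) + 3.
  have -> : 36 * q' = 4 * (q' * 3 ^+ 2) by ring.
  by rewrite E; ring.
by clear E; move: (q * q) => w; clear; lia.
Qed.

Lemma card_fix : (#|[set v : P1 | ta v == v]| <= 2)%N.
Proof.
rewrite leqNgt; apply/negP => /card_gt2P[x [y [z [[]]]]].
rewrite !inE => /eqP/inl_fix[i -> di] /eqP/inl_fix[j -> dj] /eqP/inl_fix[k -> dk].
move=> [/eqP ij /eqP jk /eqP ki].
have neq (a b : 'I_N) : inl a <> inl b :> P1 -> ~ (N%:Z %| a%:Z - b%:Z)%Z.
  by move=> ab d; apply: ab; congr inl; apply: val_inj; apply: ltn_dvdz_eq d.
have [/neq//|dij] := fix_pair _ _ di dj.
have [/neq//|djk] := fix_pair _ _ dj dk.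
apply: (neq _ _ ki).
have -> : k%:Z - i%:Z = (j%:Z + k%:Z + 1) - (i%:Z + j%:Z + 1) by ring.
by rewrite rpredB.
Qed.

(** Each side accounts for three used classes, two in [J] and its inner class. The remaining classes
    are the at most two fixed points of [ta], which the division by 3 discards. *)
Lemma complete_size F J D : state F J D ->
    (forall v, used F J v \/ ta v = v) ->
  size F = (1 + #|{: P1}| %/ 3)%N.
Proof.
move=> st full; rewrite (st_size _ _ _ st).
have cardU : #|[set v | used F J v]| = (3 * size (sides F))%N.
  have -> : [set v | used F J v] = J :|: [set v | v \in [seq sg (scls t) | t <- sides F]].
    by apply/setP => v; rewrite !inE.
  rewrite cardsU cardsE (card_uniqP (st_uniq _ _ _ st)) size_map.
  have -> : J :&: [set v | v \in [seq sg (scls t) | t <- sides F]] = finset.set0.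
    apply/setP => v; rewrite !inE; apply/negbTE/negP => /andP[vJ /mapP[t tF E]].
    by move: vJ; rewrite E (negbTE (st_disj _ _ _ st _ tF)).
  rewrite cards0 (st_card _ _ _ st); move: (size _) => x; clear; lia.
have -> : #|{: P1}| = (3 * size (sides F) + #|[set v : P1 | ta v == v]|)%N.
  rewrite -cardU -cardsUI addnC -[LHS]cardsT.
  have -> : [set v | used F J v] :&: [set v | ta v == v] = finset.set0.
    apply/setP => v; rewrite !inE; apply/negbTE/negP => /andP[uv].
    by rewrite (negbTE (st_nofix _ _ _ st _ uv)).
  rewrite cards0; congr (#|pred_of_set _|); apply/setP => v; rewrite !inE.
  by case: (full v) => [->|->]; rewrite ?eqxx ?orbT.
by have := card_fix; move: (size _) (#|_|) => x y; clear; lia.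
Qed.

(** * Sides linked to multiples of p *)

Variable r : nat.
Hypotheses (r2_le : (r * r <= N)%N) (N_lt : (N < r.+1 * r.+1)%N).

(** Equivalently, [(- y, x)] is a short vector divisible by p and of determinant N with [t]; the
    descent follows it. *)
Definition linked (x y : nat) (t : nat * nat) :=
  [/\ (0 < x <= r)%N, (0 < y <= r)%N, (p %| x)%N, (p %| y)%N &
      (t.1 * x + t.2 * y)%N = N].

(* [`|u.1 + u.2|] is the third coordinate permuted by [tau]; up to rotation and sign,
   such a [u] not divisible by [p] is a triangle of the Farey sequence F_r. *)
Definition hexfree (v : int * int) := forall u : int * int,
  (N%:Z %| cross u v)%Z -> `|u.1| <= r%:Z -> `|u.2| <= r%:Z ->
  `|u.1 + u.2| <= r%:Z -> ~~ nonp u.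

Lemma nonp_swap u : nonp (u.2, u.1) = nonp u.
Proof. by rewrite /nonp /= andbC. Qed.

Lemma hexfree_swap a b : hexfree (a, b) -> hexfree (b, a).
Proof.
move=> hf [u1 u2] d h1 h2 h12; rewrite -nonp_swap /=.
apply: hf => //=; last by rewrite addrC.
by rewrite -rpredN; move: d; congr (_ %| _)%Z; rewrite /cross /=; ring.
Qed.

Lemma r_gt2 : (2 < r)%N.
Proof.
have N9 : (3 ^ 2 <= N)%N.
  by rewrite (@leq_trans (3 ^ n)) ?leq_exp2l ?leq_exp2r.
rewrite ltnNge; apply/negP => r2.
have : (r.+1 * r.+1 <= 3 * 3)%N by rewrite leq_mul.
by move: (leq_ltn_trans N9 N_lt); rewrite expnS expn1 ltnNge => /negbTE->.
Qed.

Lemma dvdz_pairing (u v : int * int) x y : nonp v ->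
  (N%:Z %| cross u v)%Z -> (N%:Z %| v.1 * x + v.2 * y)%Z ->
  (N%:Z %| u.1 * x + u.2 * y)%Z.
Proof.
move=> npv uv; have E w : w.1 * x + w.2 * y = cross w (- y, x).
  by rewrite /cross /=; ring.
by rewrite !E; exact: cross_dvdz_trans.
Qed.

Lemma pN_le : (3 * N <= p * N)%N.
Proof. by rewrite leq_mul2r p_gt2 orbT. Qed.

(* Two lattice vectors divisible by [p] have a determinant divisible by [p * N],
   hence are proportional as soon as they are short. *)
Lemma linked_left_child a b c e x y x' y' :
    linked x y (a, b) -> coprime a b ->
    linked x' y' (c, e) -> coprime c (c + e) ->
    (N%:Z %| cross (a%:Z, b%:Z) (c%:Z, (c + e)%N%:Z))%Z ->
  (c * x + (c + e) * y)%N = N.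
Proof.
case=> /= /andP[x0 xr] /andP[y0 yr] px py Nab coab.
case=> /= /andP[x'0 x'r] /andP[y'0 y'r] px' py' Nce co dcr.
have npc : nonp (c%:Z, (c + e)%N%:Z) := nonp_coprime (c, c + e)%N co.
have npa : nonp (a%:Z, b%:Z) := nonp_coprime (a, b) coab.
have Nab' : a%:Z * x%:Z + b%:Z * y%:Z = N%:Z.
  by rewrite -Nab PoszD !PoszM.
have Nce' : c%:Z * x'%:Z + e%:Z * y'%:Z = N%:Z.
  by rewrite -Nce PoszD !PoszM.
have d_c : (c + e)%N%:Z = c%:Z + e%:Z by rewrite PoszD.
have goalZ : c%:Z * x%:Z + (c + e)%N%:Z * y%:Z = N%:Z -> (c * x + (c + e) * y)%N = N.
  by move=> E; apply/eqP; rewrite -eqz_nat PoszD !PoszM E.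
apply: goalZ; move: dcr npc; rewrite d_c => dcr npc.
have dcd : (N%:Z %| c%:Z * x%:Z + (c%:Z + e%:Z) * y%:Z)%Z.
  apply: (dvdz_pairing (c%:Z, c%:Z + e%:Z) (a%:Z, b%:Z)) => //=.
    by rewrite cross_dvdzC.
  by rewrite Nab'.
have N_gt0 : 0 < N%:Z by rewrite ltz_nat expn_gt0 prime_gt0.
have r2 : r%:Z * r%:Z <= N%:Z by rewrite -PoszM lez_nat.
have pN : 3 * N%:Z <= p%:Z * N%:Z by rewrite -!PoszM lez_nat pN_le.
have nz z : (z <= r)%N -> z%:Z <= r%:Z by rewrite lez_nat.
move: (nz _ xr) (nz _ yr) (nz _ x'r) (nz _ y'r) => {}xr {}yr {}x'r {}y'r.
have pz z : (0 < z)%N -> 0 < z%:Z by rewrite ltz_nat.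
move: (pz _ x0) (pz _ y0) (pz _ x'0) (pz _ y'0) => {}x0 {}y0 {}x'0 {}y'0.
have dz z : (p %| z)%N -> (p%:Z %| z%:Z)%Z by rewrite dvdzE.
move: (dz _ px) (dz _ py) (dz _ px') (dz _ py') => {}px {}py {}px' {}py'.
have pnS : (p ^ n.+1)%N%:Z = p%:Z * N%:Z by rewrite expnS PoszM.
have Ncd : c%:Z * (x'%:Z - y'%:Z) + (c%:Z + e%:Z) * y'%:Z = N%:Z.
  by rewrite -Nce'; ring.
clear Nab Nce d_c nz pz dz co coab.
move: (a%:Z) (b%:Z) (c%:Z) (e%:Z) (x%:Z) (y%:Z) (x'%:Z) (y'%:Z)
  Nab' Nce' dcr npc npa dcd xr yr x'r y'r x0 y0 x'0 y'0 px py px' py' Ncd.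
clear a b c e x y x' y' => a b c e x y x' y'
  Nab Nce dcr npc npa dcd xr yr x'r y'r x0 y0 x'0 y'0 px py px' py' Ncd.
have /andP[detl detr] := short_det _ _ _ _ _ _ _ x0 xr y0 yr x'0 x'r y'0 y'r r2 pN.
(* Its products with [c] and [c + e] are multiples of [p * N]: the pairings give N, the entries give
   p. Its absolute value is less than [p * N]. *)
have det0 : x * y' - y * (x' - y') = 0.
  apply: (dvdz_small _ _ detl detr).
  rewrite -pnS; apply: (dvdzX_cancel n.+1 (c, c + e)) => //=; rewrite pnS.
    have -> : c * (x * y' - y * (x' - y')) =
      y' * (c * x + (c + e) * y) - y * N%:Z by rewrite -Ncd; ring.
    by rewrite rpredB // dvdz_mul.
  have -> : (c + e) * (x * y' - y * (x' - y')) =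
    x * N%:Z - (x' - y') * (c * x + (c + e) * y) by rewrite -Ncd; ring.
  by rewrite rpredB // dvdz_mul // rpredB.
have dab : (N%:Z %| a * (x' - y') + b * y')%Z.
  by apply: (dvdz_pairing (a, b) (c, c + e)) => //=; rewrite Ncd.
have /dvdzP[k Ek] := dcd; have /dvdzP[m Em] := dab.
have N_neq0 : N%:Z != 0 by rewrite gt_eqF.
have Eky : y = k * y'.
  apply: (mulIf N_neq0); transitivity (y' * (k * N%:Z)); last by ring.
  by rewrite -Ek -Ncd -[LHS]addr0 -(mulr0 c) -det0; ring.
have Ekx : x = k * (x' - y').
  apply: (mulIf N_neq0); transitivity ((x' - y') * (k * N%:Z)); last by ring.
  by rewrite -Ek -Ncd -[RHS]addr0 -(mulr0 (c + e)) -det0; ring.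
(* As [(x, y)] is [k] times [(x' - y', y')], pairing with [(a, b)] gives [N = k * m * N]. *)
have km : k * m = 1.
  apply: (mulIf N_neq0); rewrite mul1r -[RHS]Nab {1}Ekx Eky -mulrA -Em.
  by ring.
by rewrite Ek (unitz_pos _ _ _ _ y0 y'0 Eky km) mul1r.
Qed.

Lemma linked_pairing x y a b (c d : nat) : linked x y (a, b) -> coprime a b ->
    (N%:Z %| cross (a%:Z, b%:Z) (c%:Z, d%:Z))%Z ->
    (0 < c)%N -> coprime c d ->
  exists2 k : int, 0 < k & c%:Z * x%:Z + d%:Z * y%:Z = k * N%:Z.
Proof.
case=> /= /andP[x0 xr] /andP[y0 yr] px py Nab coab dcd c0 co.
have npa : nonp (a%:Z, b%:Z) := nonp_coprime (a, b) coab.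
have /dvdzP[k Ek] : (N%:Z %| c%:Z * x%:Z + d%:Z * y%:Z)%Z.
  apply: (dvdz_pairing (c%:Z, d%:Z) (a%:Z, b%:Z)) => //=.
    by rewrite cross_dvdzC.
  by rewrite -!PoszM -PoszD Nab.
exists k => //.
have N_gt0 : 0 < N%:Z by rewrite ltz_nat expn_gt0 prime_gt0.
rewrite -(pmulr_lgt0 _ N_gt0) -Ek -!PoszM -PoszD ltz_nat addn_gt0 muln_gt0.
by rewrite c0 x0.
Qed.

(** A pairing of [2 * N] or more would force both products to be [r * r], hence [c = d = r], against
    coprimality. *)
Lemma linked_short a b c d x y : linked x y (a, b) -> coprime a b ->
    (N%:Z %| cross (a%:Z, b%:Z) (c%:Z, d%:Z))%Z ->
    (0 < c <= r)%N -> (0 < d <= r)%N -> coprime c d ->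
  (c * x + d * y)%N = N.
Proof.
move=> lk coab dcd /andP[c0 cr] /andP[d0 dr] co.
have [k k0 Ek] := linked_pairing _ _ _ _ _ _ lk coab dcd c0 co.
case: lk => /= /andP[x0 xr] /andP[y0 yr] _ _ _.
apply/eqP; rewrite -eqz_nat PoszD !PoszM Ek; apply/eqP.
have N_gt0 : 0 < N%:Z by rewrite ltz_nat expn_gt0 prime_gt0.
have r2 : r%:Z * r%:Z <= N%:Z by rewrite -PoszM lez_nat.
have [le1 | k2] := leP k 1; first by have -> : k = 1 by [clear -k0 le1; lia]; rewrite mul1r.
suff [cr' dr'] : c = r /\ d = r.
  by move: co; rewrite cr' dr' /coprime gcdnn => /eqP r1; have := r_gt2; rewrite r1.
have cx := mul_le_sqr r%:Z c%:Z x%:Z c0 cr x0 xr.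
have dy := mul_le_sqr r%:Z d%:Z y%:Z d0 dr y0 yr.
have le2 : 2 * N%:Z <= k * N%:Z by rewrite ler_pM2r.
split; apply/eqP; rewrite -eqz_nat; apply/eqP.
  apply: (mul_eq_sqr r%:Z c%:Z x%:Z) => //.
  by rewrite -Ek in le2; clear -cx dy le2 r2; lia.
apply: (mul_eq_sqr r%:Z d%:Z y%:Z) => //.
by rewrite -Ek in le2; clear -cx dy le2 r2; lia.
Qed.

(* If the pairing were [2 * N], half of [(c, c + e) + (y, - x)] would be a short
   lattice vector not divisible by [p]. *)
Lemma linked_left_child_hexfree a b c e x y :
    linked x y (a, b) -> coprime a b ->
    (0 < c <= r)%N -> (0 < e <= r)%N -> hexfree (c%:Z, e%:Z) ->
    coprime c (c + e) ->
    (N%:Z %| cross (a%:Z, b%:Z) (c%:Z, (c + e)%N%:Z))%Z ->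
  (c * x + (c + e) * y)%N = N.
Proof.
move=> lk coab /andP[c0 cr] /andP[e0 er] hf co dcd.
have [k k0 Ek] := linked_pairing _ _ _ _ _ _ lk coab dcd c0 co.
case: lk => /= /andP[x0 xr] /andP[y0 yr] px py Nab.
apply/eqP; rewrite -eqz_nat PoszD !PoszM Ek; apply/eqP.
have N_gt0 : 0 < N%:Z by rewrite ltz_nat expn_gt0 prime_gt0.
have r2 : r%:Z * r%:Z <= N%:Z by rewrite -PoszM lez_nat.
have [le1 | k2] := leP k 1; first by have -> : k = 1 by [clear -k0 le1; lia]; rewrite mul1r.
have cx := mul_le_sqr r%:Z c%:Z x%:Z c0 cr x0 xr.
have cy := mul_le_sqr r%:Z c%:Z y%:Z c0 cr y0 yr.
have ey := mul_le_sqr r%:Z e%:Z y%:Z e0 er y0 yr.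
have Ek' : c%:Z * x%:Z + c%:Z * y%:Z + e%:Z * y%:Z = k * N%:Z.
  by rewrite -Ek PoszD; ring.
(* From [3 * N] on, all three products would equal [r * r], so [c = e = r], and [(r, 2 * r)] is not
   coprime. *)
have [k3 | ge3] := ltP k 3; last first.
  have le3 : 3 * N%:Z <= k * N%:Z by rewrite ler_pM2r.
  have rc : c%:Z = r%:Z.
    apply: (mul_eq_sqr r%:Z c%:Z x%:Z) => //.
    by rewrite -Ek' in le3; clear -cx cy ey le3 r2; lia.
  have re : e%:Z = r%:Z.
    apply: (mul_eq_sqr r%:Z e%:Z y%:Z) => //.
    by rewrite -Ek' in le3; clear -cx cy ey le3 r2; lia.
  case: rc re co => -> [->]; rewrite /coprime gcdnDl gcdnn => /eqP r1.
  by have := r_gt2; rewrite r1.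
have {k2 k3 k0} k2 : k = 2 by clear -k2 k3; lia.
rewrite {}k2 in Ek; have /dvdzP[j Ej] := dcd.
have Nab' : a%:Z * x%:Z + b%:Z * y%:Z = N%:Z by rewrite -!PoszM -PoszD Nab.
rewrite /cross /= in Ej.
have N_neq0 : N%:Z != 0 by rewrite gt_eqF.
(* Cramer's rule: [(c, c + e)] is [2 * (a, b) + j * (- y, x)]. *)
have cE : c%:Z = 2 * a%:Z - j * y%:Z.
  apply: (mulIf N_neq0).
  transitivity (2 * N%:Z * a%:Z - y%:Z * (j * N%:Z)); last by ring.
  by rewrite -Ej -Ek -Nab'; ring.
have dE : (c + e)%N%:Z = 2 * b%:Z + j * x%:Z.
  apply: (mulIf N_neq0).
  transitivity (2 * N%:Z * b%:Z + x%:Z * (j * N%:Z)); last by ring.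
  by rewrite -Ej -Ek -Nab'; ring.
(* An even [j] would make both [c] and [c + e] even. *)
have /dvdzP[i Ei] : (2 %| j - 1)%Z.
  apply: contraLR co => j2; rewrite /coprime; apply/eqP => g1.
  have [h Eh] : exists h, j = 2 * h.
    by exists (j %/ 2)%Z; move/dvdzP: j2 => j2; have := divz_eq j 2;
       have := ltz_mod j (isT : 2 != 0 :> int); have := modz_ge0 j (isT : 2 != 0 :> int);
       move: (_ %/ _)%Z (_ %% _)%Z => q m m0 m2 Ej2;
       have [m0'|m1] : m = 0 \/ m = 1 by [clear -m0 m2; lia];
       [rewrite Ej2 m0'; ring | case: j2; exists q; rewrite Ej2 m1; ring].
  have : (2 %| gcdz c%:Z (c + e)%N%:Z)%Z.
    rewrite dvdz_gcd cE dE Eh -!mulrA rpredB ?rpredD ?dvdz_mulr //.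
  by rewrite dvdzE /= g1.
have {Ei} Ei : j = 2 * i + 1 by rewrite -[LHS](subrK 1) Ei mulrC.
(* The shear from [(c, c + e)] back to [(c, e)] takes [(u1, u2)] to [(u1, u2 - u1)], to which
   [hexfree] applies. *)
pose u1 := a%:Z - i * y%:Z; pose u2 := b%:Z + i * x%:Z.
have u1E : 2 * u1 = c%:Z + y%:Z by rewrite cE Ei /u1; ring.
have u2E : 2 * u2 = c%:Z + e%:Z - x%:Z by rewrite -PoszD dE Ei /u2; ring.
have cr_u : cross (u1, u2 - u1) (c%:Z, e%:Z) = N%:Z.
  apply: (mulfI (isT : 2 != 0 :> int)); rewrite -Ek /cross /= PoszD.
  transitivity ((2 * u1) * (c%:Z + e%:Z) - (2 * u2) * c%:Z); first by ring.
  by rewrite u1E u2E; ring.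
have nz z : (z <= r)%N -> z%:Z <= r%:Z by [].
have pz z : (0 < z)%N -> 0 < z%:Z by [].
move: (nz _ xr) (nz _ yr) (nz _ cr) (nz _ er) => xr' yr' cr' er'.
move: (pz _ x0) (pz _ y0) (pz _ c0) (pz _ e0) => x0' y0' c0' e0'.
have : ~~ nonp (u1, u2 - u1).
  move: (u1) (u2) u1E u2E cr_u => w1 w2 w1E w2E cr_w.
  apply: hf; first by rewrite cr_w.
  - by clear -w1E xr' yr' cr' er' x0' y0' c0' e0'; rewrite /=; lia.
  - by clear -w1E w2E xr' yr' cr' er' x0' y0' c0' e0'; rewrite /=; lia.
  - by clear -w2E xr' yr' cr' er' x0' y0' c0' e0'; rewrite /=; lia.
rewrite negbK /= => /andP[pu1 pu12].
have pu2 : (p%:Z %| u2)%Z by rewrite -(subrK u1 u2) rpredD.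
have pc : (p%:Z %| c%:Z)%Z.
  by rewrite -(addrK y%:Z c%:Z) -u1E rpredB ?dvdz_mull.
have pd : (p%:Z %| (c + e)%N%:Z)%Z.
  by rewrite PoszD -(subrK x%:Z (_ + _)) -u2E rpredD ?dvdz_mull.
by have := nonp_coprime (c, c + e)%N co; rewrite /nonp /= pc pd.
Qed.
Definition plinked (t : nat * nat) := exists x y, linked x y t.

Definition good (t : nat * nat) := (t.1 <= r)%N && (t.2 <= r)%N \/ plinked t.

Definition origin (s : nat * nat) :=
  (s.1 <= r)%N && (s.2 <= r)%N \/
  exists c e : nat, [/\ s = (c, c + e)%N \/ s = (c + e, e)%N, (0 < c)%N, (0 < e)%N &
    [/\ (c <= r)%N, (e <= r)%N & hexfree (c%:Z, e%:Z)] \/ plinked (c, e)].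

Lemma linked_swap x y a b : linked x y (a, b) -> linked y x (b, a).
Proof. by case=> ? ? ? ? /= E; split=> //=; rewrite addnC. Qed.

(** Keeps the descent inside the polygon: the side [s] is linked by the same [x] and [y]. Right
    children reduce to left ones by exchanging coordinates. *)
Lemma linked_pairing_value t s x y : linked x y t ->
    coprime t.1 t.2 -> coprime s.1 s.2 -> (0 < s.1)%N -> (0 < s.2)%N ->
    origin s -> scls t = scls s ->
  (s.1 * x + s.2 * y)%N = N.
Proof.
case: t => a b; case: s => c d /= lk cot cos c0 d0 os /eqP.
rewrite eq_cls //=; [|exact: (nonp_coprime (a, b))|exact: (nonp_coprime (c, d))].
move=> dcd; have lk' := linked_swap _ _ _ _ lk.
have dcd' : (N%:Z %| cross (b%:Z, a%:Z) (d%:Z, c%:Z))%Z.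
  by rewrite -rpredN; move: dcd; congr (_ %| _)%Z; rewrite /cross /=; ring.
have cot' : coprime b a by rewrite coprime_sym.
have cos' : coprime d c by rewrite coprime_sym.
case: os => [/andP[/= cr dr]|[c' [e [[[cE dE]|[cE dE]] c'0 e0 [[c'r er hf]|[x' [y' lk2]]]]]]].
- by apply: (linked_short a b) => //; rewrite ?c0 ?d0.
- subst c d; apply: (linked_left_child_hexfree a b) => //;
    by rewrite ?c'0 ?e0.
- subst c d.
  exact: (linked_left_child a b c' e x y x' y').
- subst c d; rewrite addnC [(c' + e)%N]addnC.
  rewrite [(c' + e)%N]addnC in cos' dcd'.
  apply: (linked_left_child_hexfree b a) => //.
  + by rewrite e0.
  + by rewrite c'0.
  + exact: hexfree_swap.
subst c d; rewrite addnC [(c' + e)%N]addnC.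
rewrite [(c' + e)%N]addnC in cos' dcd'.
exact: (linked_left_child b a e c' y x y' x' lk' cot' (linked_swap _ _ _ _ lk2)).
Qed.

(** * Every class is covered *)

Section Saturated.

Variables (F : seq nat) (J : {set P1}) (D : seq (nat * nat)).
Hypotheses (st : state F J D)
  (sum_sides : forall t, t \in sides F -> (r < t.1 + t.2)%N)
  (origin_sides : forall t, t \in sides F -> origin t)
  (max_sides : forall t, t \in sides F -> good t ->
     used F J (scls t) \/ ta (scls t) = scls t).

Definition covered (v : P1) := used F J v \/ ta v = v.

Lemma covered_ta v : covered v -> covered (ta v).
Proof. by case=> [/(st_ta _ _ _ st)|e]; [left | right; rewrite !e]. Qed.

Lemma covered_taV v : covered (ta v) -> covered v.
Proof. by move=> /covered_ta/covered_ta; rewrite taK. Qed.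

Lemma used_taV v : used F J (ta v) -> used F J v.
Proof. by move=> /(st_ta _ _ _ st)/(st_ta _ _ _ st); rewrite taK. Qed.

(** Subtractive Euclid: the parent of [(a, b)] has entry sum [maxn a b <= r], so it is not a side.
    Hence it has been inserted at, and its children are sides or inserted in turn. *)
Lemma sum_le_inserted a b :
  (0 < a)%N -> (0 < b)%N -> coprime a b -> (a <= r)%N -> (b <= r)%N ->
  (a, b) \in sides F ++ D.
Proof.
have [m] := ubnP (a + b)%N; elim: m a b => // m IH a b; rewrite ltnS => abm a0 b0 co ar br.
have inD c d : (c + d <= r)%N -> (c, d) \in sides F ++ D -> (c, d) \in D.
  by rewrite mem_cat => cd /orP[/sum_sides|//]; rewrite ltnNge cd.
have [ab|ba|ab] := ltngtP a b.
- have E : b = (a + (b - a))%N by rewrite subnKC // ltnW.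
  have h : (a, (b - a)%N) \in sides F ++ D.
    apply: IH => //; rewrite ?subn_gt0 //.
    + by rewrite -E (leq_trans _ abm) // -addn1 addnC leq_add2r.
    + by move: co; rewrite {1}E /coprime gcdnDl.
    + by rewrite (leq_trans (leq_subr _ _)).
  have hD : (a, (b - a)%N) \in D by apply: inD; rewrite // -E.
  by have [+ _] := st_children _ _ _ st _ hD; rewrite /= -E.
- have E : a = ((a - b) + b)%N by rewrite subnK // ltnW.
  have h : ((a - b)%N, b) \in sides F ++ D.
    apply: IH => //; rewrite ?subn_gt0 //.
    + by rewrite -E (leq_trans _ abm) // -addn1 leq_add2l.
    + by move: co; rewrite {1}E coprime_sym /coprime gcdnDr gcdnC.
    + by rewrite (leq_trans (leq_subr _ _)).
  have hD : ((a - b)%N, b) \in D by apply: inD; rewrite // -E.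
  by have [_ +] := st_children _ _ _ st _ hD; rewrite /= -E.
move: co; rewrite -ab /coprime gcdnn => /eqP->; exact: st_root st.
Qed.

Lemma used_01 : used F J (cls (0, 1)).
Proof.
have np1 : nonp (1, 1) by rewrite /nonp /= p_dvdz1.
have np2 : nonp (1, -1) by rewrite /nonp /= p_dvdz1.
have np3 : nonp (-1, 0) by rewrite /nonp /= rpredN p_dvdz1.
have E1 : sg (scls (1%N, 1%N)) = cls (1, -1) by rewrite /scls sg_cls.
have E2 : ta (ta (cls (1, -1))) = cls (0, 1).
  by rewrite ta_cls // /tau /= subrr oppr0 ta_cls.
rewrite -E2; apply/(st_ta _ _ _ st)/(st_ta _ _ _ st); rewrite -E1 /used.
have := st_root _ _ _ st; rewrite mem_cat => /orP[h|/(st_inserted _ _ _ st)].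
  by rewrite (map_f (fun t => sg (scls t)) h) orbT.
by move/(st_sg _ _ _ st) ->.
Qed.

Lemma used_10 : used F J (cls (1, 0)).
Proof.
have np01 : nonp (0, 1) by rewrite /nonp /= p_dvdz1 andbF.
have np10 : nonp (1, 0) by rewrite /nonp /= p_dvdz1.
have E : ta (cls (1, 0)) = cls (0, 1).
  by rewrite ta_cls // /tau /= addr0 -[RHS]cls_opp //= oppr0.
by apply: used_taV; rewrite E used_01.
Qed.

Lemma cls_scale (g : int) (u : int * int) :
  nonp (g * u.1, g * u.2) -> nonp u /\ cls (g * u.1, g * u.2) = cls u.
Proof.
move=> np; have npu : nonp u.
  by apply: contra np => /andP[h1 h2]; rewrite /= !dvdz_mull.
split=> //; apply/eqP; rewrite eq_cls //.
by rewrite (_ : cross _ _ = 0) // /cross /=; ring.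
Qed.

(* The gcd of the entries of [(a, b)] is a unit modulo [N]. *)
Lemma nonneg_cls (Q : P1 -> Prop) (a b : nat) :
    Q (cls (0, 1)) -> Q (cls (1, 0)) ->
    (forall c d : nat, (0 < c)%N -> (0 < d)%N -> coprime c d ->
      (c <= a)%N -> (d <= b)%N -> Q (scls (c, d))) ->
  nonp (a%:Z, b%:Z) -> Q (cls (a%:Z, b%:Z)).
Proof.
move=> Q01 Q10 Qco np.
have [a0|a_gt0] := posnP a.
  rewrite a0 in np *; have := cls_scale b%:Z (0, 1); rewrite /= mulr0 mulr1.
  by move=> /(_ np)[_ ->].
have [b0|b_gt0] := posnP b.
  rewrite b0 in np *; have := cls_scale a%:Z (1, 0); rewrite /= mulr0 mulr1.
  by move=> /(_ np)[_ ->].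
have g_gt0 : (0 < gcdn a b)%N by rewrite gcdn_gt0 a_gt0.
have Ea := divnK (dvdn_gcdl a b); have Eb := divnK (dvdn_gcdr a b).
move: (a %/ _)%N (b %/ _)%N Ea Eb => c d Ea Eb.
have := cls_scale (gcdn a b)%:Z (c%:Z, d%:Z); rewrite /= -!PoszM !(mulnC (gcdn a b)).
rewrite Ea Eb => /(_ np)[_ ->]; apply: Qco.
- by rewrite lt0n; apply: contraTneq a_gt0 => c0; rewrite -Ea c0.
- by rewrite lt0n; apply: contraTneq b_gt0 => d0; rewrite -Eb d0.
- have : (gcdn c d * gcdn a b)%N = gcdn a b by rewrite muln_gcdl Ea Eb.
  by move/eqP; rewrite -[X in _ == X]mul1n eqn_pmul2r //.
- by rewrite -Ea leq_pmulr.
- by rewrite -Eb leq_pmulr.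
Qed.

(** Two of [u.1], [u.2], [- (u.1 + u.2)] have the same sign, so up to [tau] and sign both entries
    are nonnegative with sum at most [r]: too short for a side. *)
Lemma hex_used (u : int * int) : nonp u -> `|u.1| <= r%:Z -> `|u.2| <= r%:Z ->
  `|u.1 + u.2| <= r%:Z -> used F J (cls u).
Proof.
have pos (a b : nat) : nonp (a%:Z, b%:Z) -> (a + b <= r)%N -> used F J (cls (a%:Z, b%:Z)).
  move=> np abr; apply: (nonneg_cls (used F J)) => //; [exact: used_01 | exact: used_10 |].
  move=> c d c0 d0 co ca db; rewrite /used.
  have cdr : (c + d <= r)%N by rewrite (leq_trans (leq_add ca db)).
  have := sum_le_inserted _ _ c0 d0 co (leq_trans (leq_addr _ _) cdr)
    (leq_trans (leq_addl _ _) cdr).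
  rewrite mem_cat => /orP[/sum_sides|/(st_inserted _ _ _ st) -> //].
  by rewrite ltnNge cdr.
have same w : nonp w -> (0 <= w.1) && (0 <= w.2) || (w.1 <= 0) && (w.2 <= 0) ->
    `|w.1 + w.2| <= r%:Z -> used F J (cls w).
  have ge0 x y : nonp (x, y) -> 0 <= x -> 0 <= y -> `|x + y| <= r%:Z -> used F J (cls (x, y)).
    move=> npx x0 y0; rewrite -(gez0_abs x0) -(gez0_abs y0) in npx *.
    by rewrite -PoszD ger0_norm // lez_nat; exact: pos.
  case: w => [x y] np /= /orP[] /andP[h1 h2] hr; first exact: ge0.
  rewrite -cls_opp //=; apply: ge0; rewrite ?oppr_ge0 //.
    by rewrite /nonp /= !rpredN.
  by rewrite -opprD normrN.
move=> np h1 h2 h12; case: u np h1 h2 h12 => a b /= np h1 h2 h12.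
have [ab|ab] := boolP ((0 <= a) && (0 <= b) || (a <= 0) && (b <= 0)).
  exact: same.
have [bc|bc] := boolP ((0 <= b) && (a + b <= 0) || (b <= 0) && (0 <= a + b)).
  apply: used_taV; rewrite ta_cls //; apply: same; rewrite ?nonp_tau //=.
    by rewrite oppr_ge0 oppr_le0.
  by rewrite opprD addrCA subrr addr0 normrN.
apply: used_taV; rewrite ta_cls //; apply: used_taV; rewrite ta_cls ?nonp_tau //.
apply: same; rewrite ?nonp_tau //=.
  by clear -ab bc; lia.
have -> : - (a + b) + - (b + - (a + b)) = - b by ring.
by rewrite normrN.
Qed.

Lemma box_covered (u : int * int) : nonp u -> `|u.1| <= r%:Z -> `|u.2| <= r%:Z ->
  (0 <= u.1) && (0 <= u.2) || (u.1 <= 0) && (u.2 <= 0) -> covered (cls u).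
Proof.
have pos (a b : nat) : nonp (a%:Z, b%:Z) -> (a <= r)%N -> (b <= r)%N ->
    covered (cls (a%:Z, b%:Z)).
  move=> np ar br; apply: (nonneg_cls covered) => //.
  - by left; exact: used_01.
  - by left; exact: used_10.
  move=> c d c0 d0 co ca db.
  have cr := leq_trans ca ar; have dr := leq_trans db br.
  have := sum_le_inserted _ _ c0 d0 co cr dr.
  rewrite mem_cat => /orP[/max_sides|/(st_inserted _ _ _ st) h]; last by left; rewrite /used h.
  by apply; left; rewrite /= cr dr.
have ge0 x y : nonp (x, y) -> 0 <= x -> 0 <= y -> `|x| <= r%:Z -> `|y| <= r%:Z ->
    covered (cls (x, y)).
  move=> npx x0 y0; rewrite -(gez0_abs x0) -(gez0_abs y0) in npx *.
  by rewrite !ger0_norm // !lez_nat; exact: pos.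
case: u => [x y] np /= hx hy /orP[] /andP[h1 h2]; first exact: ge0.
rewrite -cls_opp //=; apply: ge0; rewrite ?oppr_ge0 ?normrN //.
by rewrite /nonp /= !rpredN.
Qed.

Definition covered2 (t : nat * nat) := covered (scls t) /\ covered (sg (scls t)).

Lemma box_covered2 (t : nat * nat) : coprime t.1 t.2 -> (t.1 <= r)%N -> (t.2 <= r)%N ->
  covered2 t.
Proof.
case: t => a b /= co ar br; have np := nonp_coprime (a, b) co; split.
  by apply: box_covered => //=; rewrite ger0_norm.
left; rewrite /scls sg_cls //=; apply: hex_used; rewrite ?nonp_rot //=.
  by rewrite normrN ger0_norm.
by clear -ar br; lia.
Qed.

(** The inner class of [t] lies in the outer triangle of its parent [t']. If that is used, the inner
    class is in [J] or is that of a side equivalent to [t], which is linked too and so covered by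
    saturation. If it is fixed by [ta], then [t] is equivalent to the reverse of [t']. *)
Lemma linked_covered2 x y t t' : linked x y t -> coprime t'.1 t'.2 ->
    t = (t'.1, t'.1 + t'.2)%N \/ t = (t'.1 + t'.2, t'.2)%N ->
  covered2 t' -> covered2 t.
Proof.
case: t' => a b lk co tE [ct' csgt'].
have cot : coprime t.1 t.2.
  by case: tE => -> /=; rewrite /coprime ?gcdnDl // gcdnC gcdnDr gcdnC.
have usg v : used F J (scls (a, b)) -> v = ta (scls (a, b)) \/ v = ta (ta (scls (a, b))) ->
    used F J v.
  move=> /(st_ta _ _ _ st) u [] -> //; exact: (st_ta _ _ _ st).
have sgE : sg (scls t) = ta (scls (a, b)) \/ sg (scls t) = ta (ta (scls (a, b))).
  by case: tE => -> /=; [right; apply: sg_left_child | left; apply: sg_right_child].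
split; last first.
  by have := covered_ta _ ct' => h; case: sgE => -> //; exact: covered_ta.
case: ct' => [ut'|ft']; last first.
  suff -> : scls t = sg (scls (a, b)) by [].
  by rewrite -[LHS]sgK; case: sgE => ->; rewrite !ft'.
have := usg _ ut' sgE; rewrite /used => /orP[/(st_sg _ _ _ st)|/mapP[s sF Es]].
  by rewrite sgK => h; left; rewrite /used h.
have Ets : scls t = scls s by rewrite -[LHS]sgK Es sgK.
rewrite Ets; apply: max_sides => //; right; exists x, y.
have [s10 s20 cos] := st_side _ _ _ st _ sF.
have E := linked_pairing_value _ _ _ _ lk cot cos s10 s20 (origin_sides _ sF) Ets.
by case: lk => *; split.
Qed.

Lemma coprime_pairing (a b x y : nat) :
  nonp (a%:Z, b%:Z) -> (a * x + b * y)%N = N -> coprime a b.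
Proof.
move=> np E; have : (gcdn a b %| N)%N.
  by rewrite -E dvdn_add ?dvdn_mulr ?dvdn_gcdl ?dvdn_gcdr.
have : coprime (p ^ n) (gcdn a b).
  rewrite coprimeXl // prime_coprime //; apply: contra np => pg.
  by rewrite !dvdzE /= !(dvdn_trans pg) ?dvdn_gcdl ?dvdn_gcdr.
rewrite coprime_sym => co; rewrite -[X in (_ %| X)%N]muln1 Gauss_dvdr // dvdn1.
by [].
Qed.

(* Descent on [2 * r - (x + y)]; the representative [(a, b)] is first balanced, so
   that its parent has entries at most [r] once [x + y] exceeds [r]. *)
Lemma linked_covered m (x y : nat) (a b : int) : (2 * r - (x + y) < m)%N ->
    (0 < x <= r)%N -> (0 < y <= r)%N -> (p %| x)%N -> (p %| y)%N ->
    nonp (a, b) -> a * x%:Z + b * y%:Z = N%:Z ->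
  covered (cls (a, b)) /\ covered (sg (cls (a, b))).
Proof.
elim: m x y a b => // m IH x y a b; rewrite ltnS => xym x0r y0r px py npab Eab.
have /andP[x0 xr] := x0r; have /andP[y0 yr] := y0r.
(* Adding multiples of [(- y, x)] changes neither the class nor the pairing. *)
have [j /andP[balL balR]] := balance a b x%:Z y%:Z x0 y0.
pose a' := a - j * y%:Z; pose b' := b + j * x%:Z.
rewrite -/a' -/b' in balL balR.
have pxz : (p%:Z %| x%:Z)%Z by rewrite dvdzE.
have pyz : (p%:Z %| y%:Z)%Z by rewrite dvdzE.
have np' : nonp (a', b').
  apply: contra npab => /= /andP[h1 h2]; apply/andP; split.
    by rewrite -(subrK (j * y%:Z) a) rpredD ?dvdz_mull.
  by rewrite -(addrK (j * x%:Z) b) rpredB ?dvdz_mull.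
have -> : cls (a, b) = cls (a', b').
  apply/eqP; rewrite eq_cls //; apply/dvdzP; exists j.
  by rewrite -Eab /cross /= /a' /b'; ring.
have Eab' : a' * x%:Z + b' * y%:Z = N%:Z by rewrite -Eab /a' /b'; ring.
have r2 : r%:Z * r%:Z <= N%:Z by rewrite -PoszM lez_nat.
move: (a') (b') np' Eab' balL balR.
clear a' b' j npab Eab a b => a b npab Eab balL balR.
have a0 : 0 < a.
  have [[a0 by_]|//] := balanced_pos r%:Z N%:Z a b x%:Z y%:Z x0 xr y0 yr r2 Eab balR.
  by move: npab; rewrite /nonp /= a0 by_ pyz dvdz0.
have b0 : 0 < b.
  have Eba : b * y%:Z + a * x%:Z = N%:Z by rewrite addrC.
  have balL' : 2 * (a - b) <= y%:Z + x%:Z by clear -balL; lia.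
  have [[b0 ax]|//] := balanced_pos r%:Z N%:Z b a y%:Z x%:Z y0 yr x0 xr r2 Eba balL'.
  by move: npab; rewrite /nonp /= b0 ax pxz dvdz0.
case: a b a0 b0 npab Eab balL balR => // a [] // b a0 b0 npab Eab balL balR.
have {}Eab : (a * x + b * y)%N = N.
  by apply/eqP; rewrite -eqz_nat PoszD !PoszM Eab.
have co := coprime_pairing _ _ _ _ npab Eab.
have lk : linked x y (a, b) by split.
change (covered2 (a, b)).
have small c d : coprime c d -> (c <= r)%N -> (d <= r)%N -> covered2 (c, d).
  by move=> *; apply: box_covered2.
have [ab|ba|ab] := ltngtP a b; last first.
- move: co; rewrite -ab /coprime gcdnn => /eqP a1.
  by apply: small; rewrite ?a1 // (leq_trans x0 xr).
- have Ea : a = ((a - b) + b)%N by rewrite subnK // ltnW.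
  have co' : coprime (a - b) b.
    by move: co; rewrite {1}Ea coprime_sym /coprime gcdnDr gcdnC.
  have E' : ((a - b) * x + b * (x + y))%N = N.
    by rewrite -Eab {2}Ea mulnDl mulnDr addnA.
  apply: (linked_covered2 _ _ _ (a - b, b)%N lk) => //; first by right; rewrite /= -Ea.
  have [xyr|xyr] := leqP (x + y) r.
    apply: (IH x (x + y)%N) => //.
    + by move: xym xyr x0 y0; clear; lia.
    + by rewrite addn_gt0 x0.
    + by rewrite dvdn_add.
    + exact: (nonp_coprime (a - b, b)%N).
    + by rewrite -!PoszM -PoszD E'.
  (* Balance bounds [a - b], and [b * (x + y) <= N] with [x + y > r] bounds [b]. *)
  apply: small => //.
    by clear -balL balR xr yr ba; lia.
  apply: (sqr_bound _ _ (x + y) xyr); apply: leq_ltn_trans N_lt.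
  by rewrite -E' leq_addl.
have Eb : b = (a + (b - a))%N by rewrite subnKC // ltnW.
have co' : coprime a (b - a) by move: co; rewrite {1}Eb /coprime gcdnDl.
have E' : (a * (x + y) + (b - a) * y)%N = N.
  by rewrite -Eab {2}Eb mulnDl mulnDr addnA.
apply: (linked_covered2 _ _ _ (a, b - a)%N lk) => //; first by left; rewrite /= -Eb.
have [xyr|xyr] := leqP (x + y) r.
  apply: (IH (x + y)%N y) => //.
  + by move: xym xyr x0 y0; clear; lia.
  + by rewrite addn_gt0 x0.
  + by rewrite dvdn_add.
  + exact: (nonp_coprime (a, b - a)%N).
  + by rewrite -!PoszM -PoszD E'.
apply: small => //.
  apply: (sqr_bound _ _ (x + y) xyr); apply: leq_ltn_trans N_lt.
  by rewrite -E' leq_addr.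
by clear -balL balR xr yr ab; lia.
Qed.

(** * Lattices with a short vector divisible by p *)

Lemma nonp_add_pdiv (w u : int * int) (q : int) : nonp w -> ~~ nonp u ->
  nonp (w.1 + q * u.1, w.2 + q * u.2).
Proof.
rewrite {2}/nonp negbK => np /andP[pu1 pu2]; apply: contra np => /= /andP[h1 h2].
apply/andP; split.
  by rewrite -(addrK (q * u.1) w.1) rpredB ?dvdz_mull.
by rewrite -(addrK (q * u.2) w.2) rpredB ?dvdz_mull.
Qed.

Lemma cross_oppr w u : cross (- w.1, - w.2) (- u.1, - u.2) = cross w u.
Proof. by rewrite /cross /=; ring. Qed.

Lemma nonp_opp u : nonp (- u.1, - u.2) = nonp u.
Proof. by rewrite /nonp /= !rpredN. Qed.

Lemma opposite_covered (u w : int * int) : ~~ nonp u -> nonp w ->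
    `|u.1| <= r%:Z -> `|u.2| <= r%:Z -> u.1 * u.2 < 0 -> cross w u = N%:Z ->
  covered (cls w).
Proof.
have pos x y a b : (p%:Z %| x)%Z -> (p%:Z %| y)%Z -> nonp (a, b) -> 0 < x -> 0 < y ->
    x <= r%:Z -> y <= r%:Z -> a * x + b * y = N%:Z -> covered (cls (a, b)).
  case: x y => // x [] // y px py np x0 y0 xr yr E.
  have [] // := linked_covered _ x y a b (leqnn _) _ _ _ _ np E.
  - by apply/andP.
  - by apply/andP.
case: u w => u1 u2 [a b]; rewrite {1}/nonp negbK /= => /andP[pu1 pu2] npw h1 h2 neg E.
have [u10|u10] := ltP u1 0.
  have u20 : 0 < u2 by rewrite nmulr_rlt0 in neg.
  apply: (pos u2 (- u1)) => //; rewrite ?rpredN ?oppr_gt0 //.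
  - by rewrite -(gtr0_norm u20).
  - by rewrite -(ltr0_norm u10).
  by rewrite -E /cross /=; ring.
have {}u10 : 0 < u1.
  by rewrite lt_neqAle u10 andbT; apply: contraTneq neg => <-; rewrite mul0r.
have u20 : u2 < 0 by rewrite pmulr_rlt0 in neg.
rewrite -cls_opp //=; apply: (pos (- u2) u1); rewrite ?rpredN ?oppr_gt0 //.
- by rewrite -[(- a, - b)]/(- (a, b).1, - (a, b).2) nonp_opp.
- by rewrite -(ltr0_norm u20).
- by rewrite -(gtr0_norm u10).
by rewrite -E /cross /=; ring.
Qed.

(** Up to sign [u = (c, d)] has nonnegative entries. If [c + d <= r], a rotation of [u] has entries
    of opposite signs and the descent applies. Otherwise some [w + q * u] is short up to
    rotation. *)
Lemma pdiv_covered (u w : int * int) : ~~ nonp u -> nonp w ->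
  `|u.1| <= r%:Z -> `|u.2| <= r%:Z -> cross w u = N%:Z -> covered (cls w).
Proof.
have N_gt0 : 0 < N%:Z by rewrite ltz_nat expn_gt0 prime_gt0.
have nneg c d w' : ~~ nonp (c, d) -> nonp w' -> 0 <= c -> 0 <= d -> c <= r%:Z ->
    d <= r%:Z -> cross w' (c, d) = N%:Z -> covered (cls w').
  move=> npu npw c0 d0 cr dr E.
  have [cdr|rcd] := lerP (c + d) r%:Z.
    have [d_eq0|d_gt0] : d = 0 \/ 0 < d by clear -d0; lia.
      have c_gt0 : 0 < c.
        rewrite lt_neqAle c0 andbT eq_sym; apply: contraTneq N_gt0 => c_eq0.
        by rewrite -E c_eq0 d_eq0 /cross /= !mulr0 subrr.
      apply: covered_taV; rewrite ta_cls //; apply: covered_taV.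
      rewrite ta_cls ?nonp_tau //.
      apply: (opposite_covered (tau (tau (c, d)))); rewrite ?nonp_tau ?cross_tau //=.
      - by rewrite d_eq0; clear -c_gt0 cr; lia.
      - by rewrite d_eq0; clear -c_gt0 cr; lia.
      - by rewrite d_eq0; clear -c_gt0; nia.
    apply: covered_taV; rewrite ta_cls //.
    apply: (opposite_covered (tau (c, d))); rewrite ?nonp_tau ?cross_tau //=.
    - by clear -d0 dr; lia.
    - by clear -c0 d0 cdr; lia.
    - by clear -c0 d_gt0; nia.
  have c_gt0 : 0 < c by clear -rcd dr; lia.
  have d_gt0 : 0 < d by clear -rcd cr; lia.
  (* The translate is [(y, - x)] with [r - c < y <= r] and [x >= 0]. Either [x <= r], or its second
     rotation [(x - y, y)] has entries in [1, r]. *)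
  have [q /andP[ql qr]] := residue_window r%:Z c w'.1 c_gt0.
  have np2 := nonp_add_pdiv w' (c, d) q npw npu; rewrite /= in np2.
  have clsE : cls w' = cls (w'.1 + q * c, w'.2 + q * d).
    apply/eqP; rewrite eq_cls //; apply/dvdzP; exists q.
    by rewrite -E /cross /=; ring.
  have E2 : (w'.1 + q * c) * d + (- (w'.2 + q * d)) * c = N%:Z.
    by rewrite -E /cross /=; ring.
  rewrite clsE; move: ql qr np2 E2; rewrite -(opprK (w'.2 + q * d)).
  move: (w'.1 + q * c) (- (w'.2 + q * d)) => y x ry yr np2 E2.
  have y0 : 0 < y by clear -ry cr; lia.
  have r2 : r%:Z * r%:Z <= N%:Z by rewrite -PoszM lez_nat.
  have N_lt' : N%:Z < (r%:Z + 1) * (r%:Z + 1).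
    by rewrite -PoszD -PoszM ltz_nat !addn1.
  have x0 : 0 <= x.
    have yd := mul_le_sqr _ _ _ y0 yr d_gt0 dr.
    have E3 : x * c = N%:Z - y * d by rewrite -E2; ring.
    by rewrite -(pmulr_lge0 _ c_gt0) E3 subr_ge0 (le_trans yd).
  have [xr|rx] := lerP x r%:Z.
    left; apply: hex_used => //=.
    - by clear -y0 yr; lia.
    - by clear -x0 xr; lia.
    - by clear -x0 xr y0 yr; lia.
  have xyr := third_coordinate_small _ _ _ _ _ _ c_gt0 d_gt0 cr rcd ry N_lt' E2.
  apply: covered_taV; rewrite ta_cls //; apply: covered_taV.
  rewrite ta_cls ?nonp_tau //; apply: box_covered; rewrite ?nonp_tau //=.
  - by clear -xyr rx yr; lia.
  - by clear -y0 yr; lia.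
  - by clear -rx yr y0; lia.
case: u => u1 u2 npu npw h1 h2 E.
have [neg|] := ltP (u1 * u2) 0; first exact: (opposite_covered (u1, u2)).
move=> nn; have [u0|u0] : (0 <= u1) && (0 <= u2) \/ (u1 <= 0) && (u2 <= 0).
- exact/orP/mulr_ge0_same.
- have /andP[c0 d0] := u0; apply: (nneg u1 u2) => //.
    by rewrite -(ger0_norm c0).
  by rewrite -(ger0_norm d0).
have /andP[c0 d0] := u0; rewrite -cls_opp //.
apply: (nneg (- u1) (- u2)); rewrite ?oppr_ge0 ?nonp_opp //.
- by rewrite -[(- u1, - u2)]/(- (u1, u2).1, - (u1, u2).2) nonp_opp.
- by rewrite -(ler0_norm c0).
- by rewrite -(ler0_norm d0).
by rewrite -E -(cross_oppr w (u1, u2)).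
Qed.

(* Thue's lemma: there are more than [N] vectors with entries in [0 .. r]. *)
Lemma thue (v : int * int) : exists u : int * int,
  [/\ u != (0, 0), `|u.1| <= r%:Z, `|u.2| <= r%:Z & (N%:Z %| cross u v)%Z].
Proof.
have N_gt0 : 0 < N%:Z by rewrite ltz_nat expn_gt0 prime_gt0.
pose f (ij : 'I_r.+1 * 'I_r.+1) : int := cross (ij.1%:Z, ij.2%:Z) v.
have fN ij : (absz (f ij %% N)%Z < N)%N.
  by rewrite -ltz_nat gez0_abs ?modz_ge0 ?ltz_pmod // lt0r_neq0.
pose g ij : 'I_N := Ordinal (fN ij).
have /injectivePn[x [y xy gxy]] : ~~ injectiveb g.
  apply/injectiveP => /leq_card; rewrite card_prod !card_ord.
  by rewrite leqNgt N_lt.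
exists (x.1%:Z - y.1%:Z, x.2%:Z - y.2%:Z); split=> /=.
- apply: contraNneq xy => -[/eqP]; rewrite subr_eq0 => /eqP[e1] /eqP.
  rewrite subr_eq0 => /eqP[e2].
  by apply/eqP; case: x y e1 e2 {gxy} => ? ? [? ?] /= e1 e2; congr pair; apply: val_inj.
- by have := ltn_ord x.1; have := ltn_ord y.1; rewrite !ltnS;
    move: (nat_of_ord x.1) (nat_of_ord y.1); clear; lia.
- by have := ltn_ord x.2; have := ltn_ord y.2; rewrite !ltnS;
    move: (nat_of_ord x.2) (nat_of_ord y.2); clear; lia.
have : (f x = f y %[mod N])%Z.
  have := congr1 (fun i : 'I_N => (val i)%:Z) gxy.
  by rewrite /= !gez0_abs ?modz_ge0 // lt0r_neq0.
move=> /eqP; rewrite eqz_mod_dvd; congr (_ %| _)%Z.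
by rewrite /f /cross /=; ring.
Qed.

(** Dividing out factors within the lattice shrinks the entries, so this ends. Primitivity lets [u]
    be completed to a basis of the lattice. *)
Lemma thue_primitive (v : int * int) : exists u : int * int,
  [/\ `|u.1| <= r%:Z, `|u.2| <= r%:Z, (N%:Z %| cross u v)%Z &
      forall (k : int) u', u = (k * u'.1, k * u'.2) ->
        (N%:Z %| cross u' v)%Z -> `|k| = 1].
Proof.
have [u [u0 h1 h2 d]] := thue v.
have [m] := ubnP (absz u.1 + absz u.2)%N; elim: m u u0 h1 h2 d => // m IH u u0 h1 h2 d.
rewrite ltnS => um.
have [prim|] := pselect (forall (k : int) u', u = (k * u'.1, k * u'.2) ->
    (N%:Z %| cross u' v)%Z -> `|k| = 1); first by exists u.
move=> /existsNP[k /existsNP[[a b] /not_implyP[uE /not_implyP[d' k1]]]].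
rewrite uE /= in u0 h1 h2 um; rewrite /= in d'.
have k2 : 2 <= `|k|.
  have : k != 0 by apply: contraNneq u0 => ->; rewrite !mul0r.
  by move: k1; clear; lia.
have ab0 : (a, b) != (0, 0).
  by apply: contraNneq u0 => -[-> ->]; rewrite !mulr0.
apply: (IH (a, b)) => //=.
- by apply: le_trans h1; rewrite normrM ler_peMl // (le_trans _ k2).
- by apply: le_trans h2; rewrite normrM ler_peMl // (le_trans _ k2).
apply: leq_trans um; rewrite !abszM -mulnDr ltn_Pmull //; last first.
  rewrite addn_gt0 !absz_gt0; apply: contraNT ab0.
  by rewrite negb_or !negbK => /andP[/eqP-> /eqP->].
Qed.

Lemma all_covered v : covered v.
Proof.
rewrite -(repK v); have npv := rep_nonp v; move: (rep v) npv => {v}v npv.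
have [u [h1 h2 d prim]] := thue_primitive v.
have [npu|pu] := boolP (nonp u).
  have -> : cls v = cls u by apply/eqP; rewrite eq_cls // cross_dvdzC.
  have [neg|nn] := ltP (u.1 * u.2) 0.
    by left; apply: hex_used => //; clear -neg h1 h2; nia.
  by apply: box_covered => //; exact: mulr_ge0_same.
have /dvdzP[q Eq] := d.
have [al [be Eg]] := Bezoutz u.1 u.2.
have [s [t Est]] := Bezoutz q (gcdz u.1 u.2).
set g := gcdz u.1 u.2 in Eg Est *; set l := gcdz q g in Est *.
have lg : (l %| g)%Z by rewrite dvdz_gcdr.
have lu1 : (l %| u.1)%Z by rewrite (dvdz_trans lg) // dvdz_gcdl.
have lu2 : (l %| u.2)%Z by rewrite (dvdz_trans lg) // dvdz_gcdr.
have pg : (p%:Z %| g)%Z.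
  by rewrite dvdz_gcd; move: pu; rewrite negbK.
have l_neq0 : l != 0.
  apply/eqP => l0; rewrite l0 !dvd0z in lu1 lu2.
  have := prim 2 (0, 0); rewrite !mulr0 [u]surjective_pairing (eqP lu1) (eqP lu2).
  by move=> /(_ erefl); rewrite /cross /= !mul0r subrr dvdz0 => /(_ isT).
(* The quotient of [u] by [l] still lies in the lattice of [v]. *)
have l1 : l = 1.
  rewrite -[l]ger0_norm; last by rewrite /l /gcdz.
  apply: (prim l ((u.1 %/ l)%Z, (u.2 %/ l)%Z)).
    by rewrite [LHS]surjective_pairing !(mulrC l) !divzK.
  have lq : (l %| q)%Z by rewrite dvdz_gcdl.
  apply/dvdzP; exists (q %/ l)%Z; apply: (mulfI l_neq0).
  transitivity ((u.1 %/ l)%Z * l * v.2 - (u.2 %/ l)%Z * l * v.1).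
    by rewrite /cross /=; ring.
  by rewrite !divzK // mulrA [l * _]mulrC divzK // -Eq.
rewrite l1 in Est.
(* The second basis vector: its determinant with [u] is [(s * q + t * g) * N = N]. It is [- s * v]
   modulo N, and p does not divide [s] since it divides [g]. *)
pose w : int * int := (- s * v.1 + N%:Z * (t * be), - s * v.2 - N%:Z * (t * al)).
have npw : nonp w.
  have ps : ~~ (p%:Z %| s)%Z.
    apply/negP => ps; apply: (negP (negbT p_dvdz1)).
    have : (p%:Z %| s * q + t * g)%Z by rewrite rpredD ?(dvdz_mulr _ ps) ?(dvdz_mull _ pg).
    by rewrite Est.
  have pN : (p%:Z %| N%:Z)%Z by rewrite dvdzE /= dvdn_exp.
  apply: contra npv => /andP[h1' h2'].
  have sv1 : (p%:Z %| s * v.1)%Z.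
    have -> : s * v.1 = N%:Z * (t * be) - w.1 by rewrite /w /=; ring.
    by rewrite rpredB // (dvdz_mulr _ pN).
  have sv2 : (p%:Z %| s * v.2)%Z.
    have -> : s * v.2 = - (N%:Z * (t * al)) - w.2 by rewrite /w /=; ring.
    by rewrite rpredB // rpredN (dvdz_mulr _ pN).
  by move: sv1 sv2; rewrite !euclidz (negbTE ps) /= => -> ->.
have Ew : cross w u = N%:Z.
  transitivity (s * cross u v + N%:Z * (t * (al * u.1 + be * u.2))).
    by rewrite /cross /w /=; ring.
  by rewrite Eq Eg -[RHS]mulr1 -Est; ring.
have -> : cls v = cls w.
  apply/eqP; rewrite eq_cls //; apply/dvdzP.
  by exists (- t * (v.1 * al + v.2 * be)); rewrite /cross /w /=; ring.
exact: (pdiv_covered u).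
Qed.

End Saturated.

(** * The two rounds of insertion *)

Lemma sides_mem F t : t \in sides F -> t.1 \in F /\ t.2 \in F.
Proof.
by move=> /sides_split[s1 [s2 ->]]; rewrite !mem_cat !inE !eqxx !orbT.
Qed.

(** If used, [scls t] would be the inner class of a side [s], so
    [N <= t.1 * s.1 + t.2 * s.2 <= r * r], whence [s = (r, r)], which is not coprime. The odd form
    is below [(t.1 + t.2) ^ 2 <= N]. *)
Lemma short_side_insertable F J D t : state F J D ->
    (forall e, e \in F -> (e <= r)%N) -> t \in sides F -> (t.1 + t.2 <= r)%N ->
  ~~ used F J (scls t) /\ ta (scls t) != scls t.
Proof.
move=> st Fr tF tr; have [t10 t20 cot] := st_side _ _ _ st _ tF; split.
  rewrite /used negb_or; apply/andP; split.
    by apply: contra (st_disj _ _ _ st _ tF) => /(st_sg _ _ _ st).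
  apply/mapP => -[s sF /eqP]; have [s10 s20 cos] := st_side _ _ _ st _ sF.
  have [/Fr s1r /Fr s2r] := sides_mem _ _ sF.
  rewrite -dvdn_pairing // => /dvdn_leq; rewrite addn_gt0 !muln_gt0 t10 s10 /=.
  move=> /(_ isT) le.
  have [E1 E2] : s.1 = r /\ s.2 = r.
    have := leq_trans r2_le le.
    by move: t10 t20 tr s1r s2r; clear; move: (t.1) (t.2) (s.1) (s.2); nia.
  by move: cos; rewrite E1 E2 /coprime gcdnn => /eqP r1; have := r_gt2; rewrite r1.
rewrite -dvdn_fix //; apply/negP => /dvdn_leq.
rewrite addn_gt0 expn_gt0 t20 orbT => /(_ isT); apply/negP; rewrite -ltnNge.
apply: leq_trans r2_le; move: t10 t20 tr; clear; move: (t.1) (t.2) => a b a0 b0 ab.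
by apply: (@leq_trans ((a + b) * (a + b))); [nia | rewrite leq_mul].
Qed.

Lemma short_saturation : exists F J D, [/\ state F J D,
  forall e, e \in F -> (e <= r)%N & forall t, t \in sides F -> (r < t.1 + t.2)%N].
Proof.
have [] := saturate (fun t => t.1 + t.2 <= r)%N
  (fun F => forall e, e \in F -> (e <= r)%N) _ _ _ _ initial_state.
- move=> s1 a b s2 J D st Q /= abr _ e; have := Q e; rewrite !mem_cat !inE.
  by move=> h /or4P[h1|h1|/eqP->//|h1]; apply: h; rewrite h1 ?orbT.
- by move=> e; rewrite !inE orbb => /eqP->; apply: leq_trans r_gt2.
move=> F [J [D [st Fr sat]]]; exists F, J, D; split=> // t tF.
rewrite ltnNge; apply/negP => tr.
have [nu nf] := short_side_insertable _ _ _ _ st Fr tF tr.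
by case: (sat t tF tr) => [/(negP nu)|/eqP] //; apply/negP.
Qed.

Lemma good_saturation F0 J0 D0 : state F0 J0 D0 ->
    (forall e, e \in F0 -> (e <= r)%N) ->
    (forall t, t \in sides F0 -> (r < t.1 + t.2)%N) ->
  exists F J D, [/\ state F J D, forall v, used F J v \/ ta v = v,
    mediant_insertions F0 F &
    forall e, e \in F -> (e <= 2 * r)%N || (e <= p ^ n.-1)%N].
Proof.
move=> st0 Fr0 sum0.
pose Q F := [/\ mediant_insertions F0 F,
  forall e, e \in F -> (e <= 2 * r)%N || (e <= p ^ n.-1)%N,
  forall t, t \in sides F -> (r < t.1 + t.2)%N &
  forall t, t \in sides F -> origin t].
have [] := saturate good Q F0 J0 D0 _ st0.
- move=> s1 a b s2 J D st [med le sum or] gab nu.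
  have abF : (a, b) \in sides (s1 ++ [:: a, b & s2]).
    by rewrite sides_cat mem_cat mem_head orbT.
  have [/= a0 b0 co] := st_side _ _ _ st _ abF.
  have sideE t : t \in sides (s1 ++ [:: a, (a + b)%N, b & s2]) ->
      [\/ t \in sides (s1 ++ [:: a, b & s2]), t = (a, a + b)%N | t = (a + b, b)%N].
    rewrite !sides_cat !mem_cat !inE => /or4P[h|/eqP->|/eqP->|h];
      [constructor 1|constructor 2|constructor 3|constructor 1] => //;
    by rewrite h ?orbT.
  (* A vector contradicting [hexfree] would make the class of [(a, b)] used, by [hex_used]. *)
  have orab : [/\ (a <= r)%N, (b <= r)%N & hexfree (a%:Z, b%:Z)] \/ plinked (a, b).
    case: gab => [/= /andP[ar br]|]; [left; split=> // | by right].
    move=> u d h1 h2 h12; apply/negP => npu; move/negP: nu; apply.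
    have -> : scls (a, b) = cls u.
      have npab := nonp_coprime (a, b) co.
      by apply/eqP; rewrite eq_sym eq_cls.
    exact: (hex_used _ _ _ st sum).
  split.
  + exact: mediant_insertions_step med.
  + move=> e; have := le e; rewrite !mem_cat !inE.
    move=> h /or4P[h1|h1|/eqP->|h1]; try by apply: h; rewrite h1 ?orbT.
    case: gab => [/= /andP[ar br]|[x [y [/= /andP[x0 xr] /andP[y0 yr] px py E]]]].
      by rewrite mul2n -addnn leq_add.
    apply/orP; right; rewrite -(leq_pmul2l (prime_gt0 prime_p)) -pN_expn -E.
    by rewrite mulnDr leq_add // mulnC leq_mul // dvdn_leq.
  + move=> t /sideE[/sum //|->|->] /=.
      by rewrite (leq_trans (sum _ abF)) //= leq_addl.
    by rewrite (leq_trans (sum _ abF)) //= leq_addr.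
  move=> t /sideE[/or //|->|->]; right; exists a, b; split=> //; [by left | by right].
- split=> //.
  + exact: mediant_insertions_refl.
  + by move=> e /Fr0 er; rewrite (leq_trans er) // leq_pmull.
  move=> t /sides_mem[/Fr0 h1 /Fr0 h2]; left; by rewrite h1 h2.
move=> F [J [D [st [med le sum or] sat]]]; exists F, J, D; split=> //.
exact: (all_covered _ _ _ st sum or sat).
Qed.

End Gamma0Farey.

(** * The bound *)

Lemma fibonacci_gt0 m : (0 < fibonacci m.+1)%N.
Proof.
suff: (0 < fibonacci m.+1)%N && (0 < fibonacci m.+2)%N by case/andP.
by elim: m => //= m /andP[_ h]; rewrite h addn_gt0 h.
Qed.

Lemma fibonacci_ge2 m : (2 <= fibonacci m.+3)%N.
Proof. exact: (leq_add (fibonacci_gt0 m.+1) (fibonacci_gt0 m)). Qed.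

Lemma farey_bound (R : realType) (p n r : nat) : (2 < p)%N -> (r * r <= p ^ n)%N ->
  forall e : nat, (e <= 2 * r)%N || (e <= p ^ n.-1)%N ->
  (e%:R : R) <=
    (fibonacci p.+1)%:R / 2%:R * p%:R ^+ n.-1
    + (fibonacci p)%:R * p%:R `^ (n%:R / 2%:R).
Proof.
case: p => [|[|[|m]]] // _; set p := m.+3 => r2 e he.
have s_ge0 : 0 <= p%:R `^ (n%:R / 2%:R) :> R by exact: powR_ge0.
have r_le_s : r%:R <= p%:R `^ (n%:R / 2%:R) :> R.
  rewrite -(@ler_pXn2r _ 2) ?nnegrE ?ler0n //.
  rewrite -[leRHS]powR_mulrn // -powRrM divfK ?pnatr_eq0 //.
  by rewrite powR_mulrn ?ler0n // -!natrX ler_nat -mulnn.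
have pn_ge0 : 0 <= p%:R ^+ n.-1 :> R by rewrite exprn_ge0.
have f1 : 1 <= (fibonacci p.+1)%:R / 2%:R :> R.
  by rewrite ler_pdivlMr ?ltr0n // mul1r ler_nat fibonacci_ge2.
have f2 : 2%:R <= (fibonacci p)%:R :> R by rewrite ler_nat fibonacci_ge2.
have h1 : p%:R ^+ n.-1 <= (fibonacci p.+1)%:R / 2%:R * p%:R ^+ n.-1 :> R.
  by rewrite ler_peMl.
have h2 : 2%:R * p%:R `^ (n%:R / 2%:R) <= (fibonacci p)%:R * p%:R `^ (n%:R / 2%:R) :> R.
  by rewrite ler_wpM2r.
case/orP: he => he.
  apply: le_trans (lerD (le_trans pn_ge0 h1) h2); rewrite add0r.
  apply: le_trans (_ : (2 * r)%:R <= _); first by rewrite ler_nat.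
  by rewrite natrM ler_wpM2l.
have h3 : 0 <= 2%:R * p%:R `^ (n%:R / 2%:R) :> R by rewrite mulr_ge0.
apply: le_trans (lerD h1 (le_trans h3 h2)).
by rewrite addr0 -natrX ler_nat.
Qed.

Theorem theorem1p2 (R : realType) (p n : nat) (prime_p : prime p)
    (p_gt2 : (2 < p)%N) (n_ge2 : (2 <= n)%N) :
  exists F : seq nat,
    farey_sequence_of_Gamma0 (p ^ n)%N F /\
    forall e : nat, e \in F ->
      (e%:R : R) <=
        (fibonacci p.+1)%:R / 2%:R * p%:R ^+ n.-1
        + (fibonacci p)%:R * p%:R `^ (n%:R / 2%:R).
Proof.
have [/ssrnat.leP r2 /ssrnat.ltP N_lt] := PeanoNat.Nat.sqrt_spec (p ^ n) (le_0_n _).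
rewrite !multE in r2 N_lt; set r := Nat.sqrt _ in r2 N_lt.
have [F0 [J0 [D0 [st0 F0r sum0]]]] :=
  short_saturation p n prime_p p_gt2 n_ge2 r r2 N_lt.
have [F [J [D [st full med le]]]] :=
  good_saturation p n prime_p p_gt2 n_ge2 r r2 N_lt F0 J0 D0 st0 F0r sum0.
exists F; split; last by move=> e /le; exact: farey_bound.
split.
- exact: st_farey st.
(* The first round stops exactly at F_r, which the second refines. *)
- by rewrite -/r -(farey_denominatorsE r F0) //; exact: st_farey st0.
- exists #|{: P1 p n}|; first exact: index_Gamma0.
  exact: complete_size st full.
exact: complete_pairing st full.
Qed.
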